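(* Let $d\ge 2$ be an integer and let $\gamma\in\mathbb R$ satisfy $-d-1\le\gamma\le 1$. Let $R>0$, $L>2R$, $s>d/2+1$, and let $f\in C^\infty(\mathbb R^d)$ be a real-valued function supported in $B(0,R)$. Then there exists a constant $C=C(\gamma,d,R,L,s,\|f\|_{H^s})>0$ (depending only on the quantities listed; in particular independent of $M$, $N$, $\kappa$, $\underline f$ and of the particles and weights) such that the following holds. Let $f^N=\sum_{i=1}^N w_i\delta_{v_i}$ be an empirical probability distribution with $N\ge1$ particles $v_i\in\mathbb R^d$ and weights $w_i>0$, let $M\ge 2$ be an even integer, and let $f_M^N:=\mathcal P_M f^N\in C^\infty(\mathbb T_L^d)$. Let $\kappa>0$, let $$\Omega_\kappa:=\{v\in\mathbb R^d : f(v)>\kappa\},$$ and let the floor parameter $\underline f>0$ satisfy $\underline f\le\kappa/2$. If $$\|f_M^N-f\|_{C^0(\mathbb T_L^d)}\le\frac{\kappa}{2}\qquad\text{and}\qquad \|f_M^N-f\|_{H^s(\mathbb T_L^d)}\le 1,$$ then $$\|U_M[f_M^N]-U[f]\|_{C^0(\Omega_\kappa)}\le C\left(\frac1\kappa M^{-(s-d/2-1)}+\frac1{\kappa^2}\|f_M^N-f\|_{C^1(\mathbb T_L^d)}\right).$$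
   Context: **Torus and norms.** $\mathbb T_L^d=\mathbb R^d/(2L\mathbb Z)^d$, with fundamental domain $[-L,L]^d$. For a domain $\Omega$ and a scalar- or vector-valued function $h$, $\|h\|_{C^0(\Omega)}=\sup_{v\in\Omega}|h(v)|$ and $\|h\|_{C^1(\Omega)}=\|h\|_{C^0(\Omega)}+\|\nabla h\|_{C^0(\Omega)}$. For $s\ge0$ and periodic $h\in L^2(\mathbb T_L^d)$ with Fourier coefficients $\hat h_k=\frac1{(2L)^d}\int_{[-L,L]^d}h(v)e^{-i\pi k\cdot v/L}\,dv$, $k\in\mathbb Z^d$, $$\|h\|_{H^s(\mathbb T_L^d)}^2=(2L)^d\sum_{k\in\mathbb Z^d}\Bigl(1+\frac{\pi^2|k|^2}{L^2}\Bigr)^s|\hat h_k|^2 .$$ A function supported in $[-L,L]^d$ is identified with its $2L$-periodic extension to $\mathbb T_L^d$ (in particular in $f_M^N-f$), and $\|f\|_{H^s}$ denotes the $H^s(\mathbb T_L^d)$ norm of this extension. **Landau tensor and flux.** For $z\in\mathbb R^d\setminus\{0\}$, $A(z)=|z|^{\gamma+2}\bigl(I-\frac{z\otimes z}{|z|^2}\bigr)$, with $I$ the $d\times d$ identity matrix. For sufficiently smooth compactly supported $f,g$ on $\mathbb R^d$, $$J(f,g)(v)=\int_{\mathbb R^d}A(v-v_* )\bigl[g(v_* )\nabla f(v)-f(v)\nabla g(v_* )\bigr]\,dv_* ,$$ and the Landau velocity field is $U[f](v)=-\dfrac{J(f,f)(v)}{f(v)}$ at points where $f(v)>0$. **Periodic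 flux.** For periodic $F,G\in C^1(\mathbb T_L^d)$, $$J_{\mathrm{per}}(F,G)(v)=\int_{[-L,L]^d}A(q)\bigl[G(v-q)\nabla F(v)-F(v)\nabla G(v-q)\bigr]\,dq,$$ with $v-q$ understood modulo $2L\mathbb Z^d$ (and $\nabla G(v-q)$ the gradient of $G$ evaluated at $v-q$). **Fourier projection.** For even $M$, with $K_M=([-M/2,M/2-1]\cap\mathbb Z)^d$, $\mathcal P_Mh(v)=\sum_{k\in K_M}\hat h_ke^{i\pi k\cdot v/L}$ (applied componentwise to vector-valued $h$). For the empirical measure $f^N$, the coefficients are $\hat f^N_k=\frac1{(2L)^d}\sum_{i=1}^Nw_ie^{-i\pi k\cdot v_i/L}$, so $f_M^N=\mathcal P_Mf^N=\sum_{k\in K_M}\hat f^N_ke^{i\pi k\cdot v/L}$. **Truncated flux and approximate velocity field.** $J_M(F,G)=\mathcal P_MJ_{\mathrm{per}}(F,G)$, and, given a floor parameter $\underline f>0$, $$U_M[f_M^N](v)=-\frac{J_M(f_M^N,f_M^N)(v)}{\max\{\operatorname{Re}f_M^N(v),\underline f\}} .$$ Here $|\cdot|$ is the Euclidean (Hermitian) norm when values are complex. *)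

(* Defs.v *)
From HB Require Import structures.
From mathcomp Require Import all_boot all_order all_algebra.
From mathcomp Require Import complex.
From mathcomp Require Import all_classical all_reals all_analysis.
Import Order.TTheory GRing.Theory Num.Theory.
Import numFieldNormedType.Exports.

Set Implicit Arguments.
Unset Strict Implicit.
Unset Printing Implicit Defensive.

Local Open Scope classical_set_scope.
Local Open Scope ring_scope.

(* Over a MathComp-Analysis realType R, with complex numbers R[i]. A function on
   the torus R^d / (2L Z)^d is a 2L-periodic function on R^d, with fundamental
   domain [cube d L]; frequencies k in Z^d have type 'rV[int]_d. *)

(* Lebesgue measure on R^n, carried by n.-tuple R since this type, unlike
   'rV[R]_n, has a product sigma-algebra in the library. *)

Section lebesgue_product.
Variable R : realType.
Local Notation mR := (measurableTypeR R).

Definition tcons n (p : mR * n.-tuple mR) : n.+1.-tuple mR :=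
  [the n.+1.-tuple mR of p.1 :: p.2].

Lemma measurable_tcons n : measurable_fun [set: mR * n.-tuple mR] (@tcons n).
Proof. by apply: measurable_cons. Qed.

Section step.
Variables (n : nat) (m : {sigma_finite_measure set (n.-tuple mR) -> \bar R}).

Definition lebesgue_cons : set (n.+1.-tuple mR) -> \bar R :=
  pushforward (@lebesgue_measure R \x m)%E (@tcons n).

Let mu : {measure set (mR * n.-tuple mR)%type -> \bar R} :=
  (@lebesgue_measure R \x m)%E.

Let pf : {measure set (n.+1.-tuple mR) -> \bar R} :=
  measure_function_pushforward__canonical__measure_function_Measure mu
    (@measurable_tcons n).

Let lebesgue_cons0 : lebesgue_cons set0 = 0%E.
Proof. exact: (measure0 pf). Qed.

Let lebesgue_cons_ge0 A : (0 <= lebesgue_cons A)%E.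
Proof. exact: (measure_ge0 pf). Qed.

Let lebesgue_cons_sigma_additive : semi_sigma_additive lebesgue_cons.
Proof. exact: (@measure_semi_sigma_additive _ _ _ pf). Qed.

HB.instance Definition _ := isMeasure.Build _ _ _ lebesgue_cons
  lebesgue_cons0 lebesgue_cons_ge0 lebesgue_cons_sigma_additive.

Let lebesgue_cons_sigma_finite : sigma_finite setT lebesgue_cons.
Proof.
have /sigma_finiteP[F [FT ndF Foo]] := sigma_finiteT (@lebesgue_measure R).
have /sigma_finiteP[G [GT ndG Goo]] := sigma_finiteT m.
exists (fun k => [set t : n.+1.-tuple mR |
    F k (thead t) /\ G k [tuple of behead t]]).
  apply/seteqP; split => // t _.
  have [i _ Fi] : (\bigcup_i F i) (thead t) by rewrite -FT.
  have [j _ Gj] : (\bigcup_i G i) [tuple of behead t] by rewrite -GT.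
  exists (maxn i j) => //; split.
    by move: (thead t) Fi; exact/subsetPset/ndF/leq_maxl.
  by move: [tuple of behead t] Gj; exact/subsetPset/ndG/leq_maxr.
move=> k; have [mF Fk] := Foo k; have [mG Gk] := Goo k; split.
  rewrite [X in measurable X](_ : _ =
    (fun t : n.+1.-tuple mR => tnth t ord0) @^-1` F k `&`
    (fun t : n.+1.-tuple mR => [tuple of behead t]) @^-1` G k)//.
  apply: measurableI; rewrite -[X in measurable X]setTI.
    exact: (measurable_tnth ord0).
  exact: measurable_behead.
rewrite /lebesgue_cons /pushforward (_ : _ @^-1` _ = F k `*` G k).
  by rewrite product_measure1E// lte_mul_pinfty// ge0_fin_numE.
have beheadE (x : mR) (t : n.-tuple mR) :
    [tuple of behead (tcons (x, t))] = t by exact/val_inj.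
by apply/seteqP; split => -[x t] /=; rewrite beheadE.
Qed.

HB.instance Definition _ := Measure_isSigmaFinite.Build _ _ _ lebesgue_cons
  lebesgue_cons_sigma_finite.

End step.

Fixpoint lebesgue_tuple n : {sigma_finite_measure set (n.-tuple mR) -> \bar R} :=
  if n is n'.+1 then lebesgue_cons (lebesgue_tuple n')
  else \d_([tuple] : 0.-tuple mR).

End lebesgue_product.

Section vectors.
Variables (R : realType) (d : nat).
Implicit Types (v z : 'rV[R]_d) (h : 'rV[R]_d -> R[i]) (D : set 'rV[R]_d).

(* The library norm on 'rV[R]_d is the max norm, hence these. *)
Definition enorm v : R := Num.sqrt (\sum_(i < d) v 0 i ^+ 2).

Definition cabs (z : R[i]) : R := ComplexField.Normc.normc z.

Definition hnorm (z : 'rV[R[i]]_d) : R :=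
  Num.sqrt (\sum_(i < d) cabs (z 0 i) ^+ 2).

Definition tocplx (x : R) : R[i] := (x%:C)%C.

Definition vtocplx v : 'rV[R[i]]_d := map_mx tocplx v.

Definition cis (theta : R) : R[i] := (cos theta +i* sin theta)%C.

Definition partial (i : 'I_d) (f : 'rV[R]_d -> R) : 'rV[R]_d -> R :=
  'D_('e_i) f.

Definition grad (f : 'rV[R]_d -> R) v : 'rV[R]_d := \row_i partial i f v.

(* Partial derivatives in the real directions e_i of a complex-valued h. *)
Definition cgrad h v : 'rV[R[i]]_d :=
  \row_i (partial i (fun x => complex.Re (h x)) v
          +i* partial i (fun x => complex.Im (h x)) v)%C.

(* C^infinity: all iterated partial derivatives exist and are continuous. *)
Definition smooth (f : 'rV[R]_d -> R) : Prop :=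
  forall l : seq 'I_d, let g := foldr partial f l in
    continuous g /\ forall v i, derivable g v 'e_i.

Definition vint D (f : 'rV[R]_d -> R) : R :=
  \int[lebesgue_tuple R d]_(t in [set t | D (\row_i tnth t i)])
    f (\row_i tnth t i).

Definition cint D h : R[i] :=
  (vint D (fun v => complex.Re (h v)) +i* vint D (fun v => complex.Im (h v)))%C.

(* sup_(v in D) g v, applied to nonnegative g; it is 0 when D is empty. *)
Definition supn D (g : 'rV[R]_d -> R) : \bar R :=
  Order.max 0%E (ereal_sup [set (g v)%:E | v in D]).

Definition C0norm D h : \bar R := supn D (fun v => cabs (h v)).

Definition C0vnorm D (u : 'rV[R]_d -> 'rV[R[i]]_d) : \bar R :=
  supn D (fun v => hnorm (u v)).

Definition C1norm D h : \bar R := (C0norm D h + C0vnorm D (cgrad h))%E.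

End vectors.

Section torus.
Variables (R : realType) (d : nat) (L : R).
Implicit Types (v : 'rV[R]_d) (h : 'rV[R]_d -> R[i]) (k : 'rV[int]_d).

Definition cube : set 'rV[R]_d := [set v | forall i, - L <= v 0 i <= L].

(* The representative of x modulo 2L in [-L, L). *)
Definition torus_repr (x : R) : R := x - 2 * L * (Num.floor ((x + L) / (2 * L)))%:~R.

(* The 2L-periodic extension of the restriction of f to the cube. *)
Definition per_ext (f : 'rV[R]_d -> R) v : R := f (map_mx torus_repr v).

Definition kdot k v : R := \sum_(i < d) (k 0 i)%:~R * v 0 i.

Definition ksq k : R := \sum_(i < d) ((k 0 i)%:~R : R) ^+ 2.

Definition fourier_mode k v : R[i] := cis (pi * kdot k v / L).

Definition fourier_coef h k : R[i] :=
  tocplx ((2 * L) ^- d) * cint cube (fun v => h v * cis (- (pi * kdot k v / L))).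

(* Extended-real valued: +oo when the series diverges. *)
Definition Hsnorm (s : R) h : \bar R :=
  poweR (((2 * L) ^+ d)%:E *
    \esum_(k in [set: 'rV[int]_d])
      ((1 + pi ^+ 2 * ksq k / L ^+ 2) `^ s * cabs (fourier_coef h k) ^+ 2)%:E)
    2^-1.

(* For even M, the frequencies with -M/2 <= k_i <= M/2 - 1 for all i. *)
Definition KM (M : nat) : set 'rV[int]_d :=
  [set k | forall i, - (M./2)%:Z <= k 0 i <= (M./2)%:Z - 1].

Definition trig_poly (M : nat) (c : 'rV[int]_d -> R[i]) v : R[i] :=
  \sum_(k \in KM M) c k * fourier_mode k v.

Definition proj (M : nat) h : 'rV[R]_d -> R[i] := trig_poly M (fourier_coef h).

Definition vproj (M : nat) (u : 'rV[R]_d -> 'rV[R[i]]_d) v : 'rV[R[i]]_d :=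
  \row_i proj M (fun x => u x 0 i) v.

(* Fourier coefficients of sum_i w_i delta_(p_i). *)
Definition empirical_coef (N : nat) (w : 'I_N -> R) (p : 'I_N -> 'rV[R]_d) k :
    R[i] :=
  tocplx ((2 * L) ^- d) *
  \sum_(i < N) tocplx (w i) * cis (- (pi * kdot k (p i) / L)).

Definition empirical_proj (M N : nat) (w : 'I_N -> R) (p : 'I_N -> 'rV[R]_d) :
    'rV[R]_d -> R[i] :=
  trig_poly M (empirical_coef w p).

End torus.

Arguments cube {R} d L.

Section landau.
Variables (R : realType) (d : nat) (gamma : R).
Implicit Types (f g : 'rV[R]_d -> R) (F G : 'rV[R]_d -> R[i]) (v z : 'rV[R]_d).

(* The value at z = 0 is immaterial (null set). As vectors are rows and the
   tensor is symmetric, A(z) x is written x *m landauA z below. *)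
Definition landauA z : 'M[R]_d :=
  enorm z `^ (gamma + 2) *: (1%:M - (enorm z ^+ 2)^-1 *: (z^T *m z)).

Definition flux f g v : 'rV[R]_d :=
  \row_i vint [set: 'rV[R]_d] (fun vs =>
    ((g vs *: grad f v - f v *: grad g vs) *m landauA (v - vs)) 0 i).

Definition velocity f v : 'rV[R]_d := - ((f v)^-1 *: flux f f v).

Definition flux_per (L : R) F G v : 'rV[R[i]]_d :=
  \row_i cint (cube d L) (fun q =>
    ((G (v - q) *: cgrad F v - F v *: cgrad G (v - q))
       *m map_mx (@tocplx R) (landauA q)) 0 i).

Definition flux_trunc (L : R) (M : nat) F G : 'rV[R]_d -> 'rV[R[i]]_d :=
  vproj L M (flux_per L F G).

(* fl is the floor parameter. *)
Definition velocity_trunc (L : R) (M : nat) (fl : R) F v : 'rV[R[i]]_d :=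
  - (tocplx (Num.max (complex.Re (F v)) fl)^-1 *: flux_trunc L M F F v).

End landau.

(* Main.v *)
Require Import Defs.
From HB Require Import structures.
From mathcomp Require Import all_boot all_order all_algebra.
From mathcomp Require Import complex.
From mathcomp Require Import all_classical all_reals all_analysis.
From mathcomp Require Import measurable_realfun esum ring lra zify.
Import Order.TTheory GRing.Theory Num.Theory.
Import numFieldNormedType.Exports.

Set Implicit Arguments.
Unset Strict Implicit.
Unset Printing Implicit Defensive.

Local Open Scope classical_set_scope.
Local Open Scope ring_scope.

(** Write F for the empirical projection f_M^N, e for its distance to f, J for the
periodic flux of F with itself, j for the flux of f, and m for the denominator
max(Re F, floor). Where f exceeds kappa, the bound |F - f| <= kappa / 2 forces
Re F >= kappa / 2, so the floor is inactive, m = Re F, and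
  - P_M J / m + j / f = (J - P_M J) / m - (J - j) / m + j (1 / f - 1 / m).
Each of the three terms is estimated separately ([quotient_diff_le]).

All constants come from one number, the Wiener norm
  W(F) = sum_k (1 + pi^2 |k|^2 / L^2)^(1/2) |F_k|,
which bounds |F| and every partial derivative of F. Orthogonality of the
Fourier modes identifies F_k with the sum of the coefficients of f and of F - f, so the
weighted l^2 norm of (F_k) is bounded in terms of the H^s norm of f, and
Cauchy-Schwarz ([wiener_le_sobolev]) bounds W(F), because the weights
(1 + pi^2 |k|^2 / L^2)^(1-s) are summable for s - 1 > d / 2
([sum_weight_bounded]). The function f is always written F - (F - f): its size
is controlled by W(F) and by e, and a product of two errors is harmless
because one of its factors is at most kappa / 2 <= |F(v)| <= W(F).

First term. J is an explicit finite sum over pairs of frequencies (k, l),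
with mode k + l and with a coefficient of order at most
|F_k| |F_l| (1 + |k| + |l|) times the mass of the Landau tensor. The projection
removes exactly the pairs with k + l outside K_M; then k or l has a component of size
at least M / 4. Frequencies between M / 4 and M / 2 form a single dyadic
shell with at most M^d elements, so Cauchy-Schwarz on it gives the rate
M^-(s - d/2 - 1) ([sum_weight_high_freq], [flux_trunc_error_le]).

Second and third terms. The flux of f is an integral over the cube, since
f lives in a ball of radius r < L / 2 ([flux_cubeE]); the two flux integrands
then differ pointwise by 6 W(F) e times the Landau tensor ([flux_diff]).
Integrability of the tensor for gamma >= - d - 1 comes from the bound
|z|^(gamma + 2) <= C |z|^(1 - d) on the cube and a dyadic decomposition
around the origin ([integrable_landauA]). *)

(** * Lebesgue measure on tuples *)

Section tuple_measure.
Variable R : realType.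
Local Notation mR := (measurableTypeR R).
Local Notation leb := (lebesgue_tuple R).

(** The measure on tuples is a pushforward of a product measure: this one-variable
unfolding is what all inductions on the dimension use. *)
Lemma tuple_tonelli n (f : n.+1.-tuple mR -> \bar R) :
  measurable_fun [set: n.+1.-tuple mR] f -> (forall t, 0 <= f t)%E ->
  (\int[leb n.+1]_t f t =
   \int[@lebesgue_measure R]_x \int[leb n]_t f (tcons (x, t)))%E.
Proof.
move=> mf f0; have mc := @measurable_tcons R n.
transitivity (\int[(@lebesgue_measure R \x leb n)%E]_p f (tcons p))%E.
  rewrite -[RHS](ge0_integral_pushforward mc _ measurableT)//.
rewrite fubini_tonelli1//; exact: (measurableT_comp mf mc).
Qed.

Lemma tnth_tcons0 n x (t : n.-tuple mR) : tnth (tcons (x, t)) ord0 = x.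
Proof. by rewrite tnth0. Qed.

Lemma tnth_tconsS n x (t : n.-tuple mR) i :
  tnth (tcons (x, t)) (lift ord0 i) = tnth t i.
Proof. by rewrite tnthS. Qed.

Definition tcube n (L : R) : set (n.-tuple mR) :=
  [set t | forall i, - L <= tnth t i <= L].

Lemma measurable_tcube n L : measurable (@tcube n L).
Proof.
rewrite (_ : tcube L = \bigcap_(i in setT) (fun t : n.-tuple mR => tnth t i) @^-1` `[-L, L]).
  apply: fin_bigcap_measurable; first exact: finite_finset.
  move=> i _; rewrite -[X in measurable X]setTI; apply: measurable_tnth => //.
apply/seteqP; split=> t /= h; first by move=> i _ /=; rewrite in_itv /=.
by move=> i; have := h i I; rewrite /= in_itv.
Qed.

Lemma mem_tcube_cons n L x (t : n.-tuple mR) :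
  (tcons (x, t) \in tcube L) = (x \in `[-L, L]%classic) && (t \in tcube L).
Proof.
apply/idP/andP => [/set_mem h|[/set_mem /=]].
  split; apply/mem_set => /=; first by have := h ord0; rewrite tnth_tcons0 in_itv.
  by move=> i; have := h (lift ord0 i); rewrite tnth_tconsS.
rewrite in_itv /= => hx /set_mem ht; apply/mem_set => i.
case: (unliftP ord0 i) => [j|] ->; last by rewrite tnth_tcons0.
by rewrite tnth_tconsS; apply: ht.
Qed.

Lemma tcube_tuple0 L : @tcube 0 L = setT.
Proof. by apply/seteqP; split=> t //= _ []. Qed.

Lemma integral_tuple0 (f : 0.-tuple mR -> \bar R) :
  measurable_fun [set: 0.-tuple mR] f -> (\int[leb 0]_t f t = f [tuple])%E.
Proof. by move=> mf; rewrite /= integral_dirac// diracT mul1e. Qed.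

(** Induction on the dimension with Tonelli; in dimension one, the image of
Lebesgue measure under x |-> a - x gives intervals the same length.
The vector [v] is a function on nat so that its tail needs no cast. *)
Lemma integral_tuple_reflect n (v : nat -> R) (h : n.-tuple mR -> \bar R) :
  measurable_fun [set: n.-tuple mR] h -> (forall t, 0 <= h t)%E ->
  (\int[leb n]_t h [tuple (v i - tnth t i)%R | i < n] = \int[leb n]_t h t)%E.
Proof.
have mrefl m (u : nat -> R) : measurable_fun [set: m.-tuple mR]
    (fun t : m.-tuple mR => [tuple u i - tnth t i | i < m] : m.-tuple mR).
  apply/measurable_fun_tnthP => i.
  rewrite (_ : _ \o _ = (fun t : m.-tuple mR => u i - tnth t i)).
    by apply: measurable_funB => //; exact: measurable_tnth.
  by apply/funext => t /=; rewrite tnth_mktuple.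
elim: n v h => [|n IH] v h mh h0.
  rewrite !integral_tuple0 //; first by congr h; apply: eq_from_tnth => -[].
  exact: (measurableT_comp mh (mrefl _ _)).
rewrite !tuple_tonelli //; last exact: (measurableT_comp mh (mrefl _ _)).
transitivity (\int[lebesgue_measure]_x \int[leb n]_t h (tcons ((v 0%N - x)%R, t)))%E.
  apply: eq_integral => x _.
  rewrite -(IH (fun i => v i.+1) (fun t => h (tcons (v 0%N - x, t)))) //.
    apply: eq_integral => t _; congr h; apply: eq_from_tnth => i.
    rewrite tnth_mktuple; case: (unliftP ord0 i) => [j|] ->.
      by rewrite !tnth_tconsS tnth_mktuple.
    by rewrite !tnth_tcons0.
  exact: (measurable_fun_pair2 _ (measurableT_comp mh (@measurable_tcons R n))).
pose F x := (\int[leb n]_t h (tcons (x, t)))%E.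
have mF : measurable_fun setT F.
  apply: (measurable_fun_fubini_tonelli_F (m2 := leb n) (fun p => h (tcons p))) => //.
  exact: (measurableT_comp mh (@measurable_tcons R n)).
have F0 x : (0 <= F x)%E by apply: integral_ge0.
have mphi : measurable_fun setT (fun x : mR => v 0%N - x : mR) by exact: measurable_funB.
rewrite -[LHS]/(\int[lebesgue_measure]_(x in setT) (F \o (fun x => v 0%N - x)%R) x)%E.
rewrite -[in LHS](preimage_setT (fun x : mR => v 0%N - x : mR)).
rewrite -(ge0_integral_pushforward mphi) //.
apply: eq_measure_integral => A mA _; apply/esym/lebesgue_measure_unique => //= _ [[a b]] _ <-.
rewrite /pushforward/=.
rewrite (_ : _ @^-1` _ = `[v 0%N - b, v 0%N - a[%classic).
  rewrite !lebesgue_measure_itv/= !lte_fin ltrD2l ltrN2.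
  by case: ifP => // _; rewrite !EFinN -!EFinD; congr (_%:E); ring.
by apply/seteqP; split => x /=; rewrite !in_itv /= => /andP[? ?]; apply/andP; split; lra.
Qed.

(** Tonelli for the cube, which is the product of a segment and a cube of lower
dimension. *)
Lemma tuple_tonelli_cube n L (f : n.+1.-tuple mR -> R) :
  measurable_fun [set: n.+1.-tuple mR] f -> (forall t, 0 <= f t) ->
  (\int[leb n.+1]_(t in tcube L) (f t)%:E =
   \int[@lebesgue_measure R]_(x in `[(- L)%R, L]) \int[leb n]_(t in tcube L) (f (tcons (x, t)))%:E)%E.
Proof.
move=> mf f0; rewrite integral_mkcond.
have mP : measurable_fun [set: n.+1.-tuple mR] ((fun t => (f t)%:E) \_ (tcube L)).
  apply/(measurable_restrict _ (measurable_tcube L) measurableT).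
  by rewrite setTI; apply/measurable_EFinP; apply: measurable_funTS.
rewrite tuple_tonelli //; last first.
  by move=> t; rewrite erestrict_ge0// => ? _; rewrite lee_fin.
rewrite [in RHS]integral_mkcond; apply: eq_integral => x _.
rewrite [in RHS]patchE; case: ifPn => xL.
  rewrite [in RHS]integral_mkcond; apply: eq_integral => t _.
  rewrite !patchE; congr (if _ then _ else _).
  by rewrite mem_tcube_cons xL.
by apply: integral0_eq => t _; rewrite patchE mem_tcube_cons (negbTE xL).
Qed.

Lemma measure_tcube n L : 0 <= L -> leb n (tcube L) = ((2 * L) ^+ n)%:E.
Proof.
move=> L0; elim: n => [|n IH].
  by rewrite tcube_tuple0 /= diracT.
transitivity (\int[leb n.+1]_(t in tcube L) (1 : R)%:E)%E.
  by rewrite integral_cst ?mul1e //; exact: measurable_tcube.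
rewrite (@tuple_tonelli_cube _ _ (fun=> 1)) //.
transitivity (\int[@lebesgue_measure R]_(x in `[(- L)%R, L]) ((2 * L) ^+ n)%:E)%E.
  by apply: eq_integral => x _; rewrite integral_cst ?mul1e -?IH //; exact: measurable_tcube.
rewrite integral_cst //= lebesgue_measure_itv /= lte_fin.
case: ltgtP => [||hL].
- by move=> _; rewrite -EFinD -EFinM exprS; congr (_%:E); ring.
- by move=> h; exfalso; lra.
- by rewrite mule0 (_ : L = 0) ?mulr0 ?expr0n//; lra.
Qed.

End tuple_measure.

(** * Measurability and orthogonality of phases on the cube *)

Section tuple_functions.
Variable R : realType.
Local Notation mR := (measurableTypeR R).
Local Notation leb := (lebesgue_tuple R).

(** The measurable sets of tuples are generated by coordinates and not by open
sets, so continuity has to be turned into measurability: a continuous function is the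
pointwise limit of its values at the lower grid points of mesh 1 / (n + 1), and each of
these approximations takes countably many values, on boxes. *)
Lemma measurable_continuous_row d (g : 'rV[R]_d -> R) : continuous g ->
  measurable_fun [set: d.-tuple mR] (fun t => g (\row_i tnth t i)).
Proof.
move=> cg.
pose fl n (t : d.-tuple mR) : 'rV[int]_d :=
  \row_i Num.floor (n.+1%:R * tnth t i).
pose pt n (k : 'rV[int]_d) : 'rV[R]_d := \row_i ((k 0 i)%:~R / n.+1%:R).
apply: (@measurable_fun_cvg _ _ _ _ (fun n t => g (pt n (fl n t)))).
  move=> n _ Y mY; rewrite setTI.
  rewrite (_ : _ @^-1` _ = \bigcup_(k in [set: 'rV[int]_d])
      (if `[< Y (g (pt n k)) >] then \bigcap_(i in [set: 'I_d]) [set t : d.-tuple mR |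
        (k 0 i)%:~R <= n.+1%:R * tnth t i < (k 0 i + 1)%:~R] else set0)).
    apply: countable_bigcupT_measurable => // k; case: ifP => // _.
    apply: fin_bigcap_measurable; first exact: finite_finset.
    move=> i _.
    rewrite (_ : [set _ | _] = (fun t : d.-tuple mR => n.+1%:R * tnth t i) @^-1`
       `[(k 0 i)%:~R, (k 0 i + 1)%:~R[%classic); last first.
      by apply/seteqP; split=> t /=; rewrite in_itv.
    rewrite -[X in measurable X]setTI.
    have : measurable_fun [set: d.-tuple mR] (fun t : d.-tuple mR => n.+1%:R * tnth t i).
      by apply: measurable_funM => //; exact: measurable_tnth.
    exact.
  apply/seteqP; split=> t /=.
    move=> Yt; exists (fl n t) => //; rewrite ifT; last exact/asboolP.
    by move=> i _ /=; rewrite mxE real_floor_le ?num_real //= real_floorD1_gt ?num_real.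
  move=> [k _]; case: ifP => // /asboolP Yk hk; rewrite (_ : fl n t = k) //.
  apply/rowP => i; rewrite mxE; apply: floor_def; exact: (hk i I).
move=> t _; apply/cvgrPdist_lt => e e0.
have /cvgrPdist_lt/(_ e e0) := cg (\row_i tnth t i).
move=> /nbhs_ballP [del /= del0 Hdel].
have := near_infty_natSinv_lt (PosNum del0).
apply: filterS => n /= hn; apply: Hdel.
split => // i j; rewrite !mxE /ball /= .
have n0 : (0 : R) < n.+1%:R by [].
have := real_floor_le (num_real (n.+1%:R * tnth t j)).
have := real_floorD1_gt (num_real (n.+1%:R * tnth t j)).
rewrite intrD; set F := (_%:~R : R) => h1 h2.
rewrite ltr_norml; apply/andP; split.
  rewrite -subr_gt0 (_ : _ - _ = del + (n.+1%:R * tnth t j - F) / n.+1%:R);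
    last by field; rewrite lt0r_neq0.
  by apply: ltr_wpDr => //; apply: divr_ge0; lra.
apply: le_lt_trans hn; rewrite -subr_ge0.
rewrite (_ : _ - _ = (F + 1 - n.+1%:R * tnth t j) / n.+1%:R); last by field; rewrite lt0r_neq0.
by apply: divr_ge0; lra.
Qed.

Lemma sin_piz (k : int) : sin (pi * k%:~R) = 0 :> R.
Proof.
have h n : sin (pi * n%:R) = 0 :> R.
  elim: n => [|n IH]; first by rewrite mulr0 sin0.
  by rewrite -natr1 mulrDr mulr1 sinDpi IH oppr0.
case: k => n; first exact: h.
by rewrite NegzE mulrNz mulrN sinN h oppr0.
Qed.

Lemma onePcos_ge0 (x : R) : 0 <= 1 + cos x.
Proof. by have := cos_geN1 x; lra. Qed.

Lemma integral_segment_1Pcos (L th b : R) (k : int) : 0 < L ->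
  (\int[@lebesgue_measure R]_(x in `[(- L)%R, L])
     (1 + b * cos (th + pi / L * k%:~R * x))%:E =
   (2 * L * (1 + b * ((k == 0)%:R * cos th)))%:E)%E.
Proof.
move=> L0; have [->|k0] := eqVneq k 0.
  under eq_integral do rewrite mulr0 mul0r addr0.
  rewrite integral_cst //= lebesgue_measure_itv /= lte_fin ifT; last by lra.
  by rewrite -EFinD -EFinM mul1r; congr (_%:E); ring.
rewrite mul0r mulr0 addr0 mulr1.
set a := pi / L * k%:~R.
have a0 : a != 0.
  by rewrite !mulf_eq0 invr_eq0 intr_eq0 (negbTE k0) !gt_eqF ?pi_gt0.
pose F x := x + b * (a^-1 * sin (th + a * x)).
have dF x : is_derive (x : R) (1 : R) F (1 + b * cos (th + a * x)).
  rewrite /F; apply: is_derive_eq.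
  by rewrite /GRing.scale /=; field.
rewrite (@continuous_FTC2 _ _ F).
- rewrite -EFinB; congr (_%:E); rewrite /F.
  rewrite mulrN !sinD cosN sinN (_ : a * L = pi * k%:~R); last by rewrite /a; field; rewrite gt_eqF.
  by rewrite sin_piz; ring.
- by lra.
- apply: continuous_subspaceT => x.
  have cc : continuous (fun x : R => 1 + b * cos (th + a * x)).
    move=> y; apply: cvgD; first exact: cvg_cst.
    apply: cvgM; first exact: cvg_cst.
    apply: continuous_comp; last exact: continuous_cos.
    by apply: cvgD; [exact: cvg_cst | apply: cvgM; [exact: cvg_cst|exact: cvg_id]].
  exact: cc.
- have cF : continuous F by move=> x; apply/differentiable_continuous/derivable1_diffP.
  split; first by move=> x _.
    by apply: cvg_at_right_filter; exact: cF.
  by apply: cvg_at_left_filter; exact: cF.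
- by move=> x _; rewrite derive1E derive_val.
Qed.

Lemma measurable_phase n (th : R) (a : 'I_n -> R) :
  measurable_fun [set: n.-tuple mR] (fun t => th + \sum_(i < n) a i * tnth t i).
Proof.
apply: measurable_funD => //; apply: measurable_sum => i.
by apply: measurable_funM => //; exact: measurable_tnth.
Qed.

Lemma measurable_cos_phase n (th : R) (a : 'I_n -> R) :
  measurable_fun [set: n.-tuple mR] (fun t => cos (th + \sum_(i < n) a i * tnth t i)).
Proof.
apply: (measurableT_comp _ (@measurable_phase n th a)).
by apply: continuous_measurable_fun; exact: continuous_cos.
Qed.

(** Orthogonality of the modes, by induction on the dimension: integrating one
coordinate either leaves the phase [th] alone or kills the cosine. The phase is
there because the inner integral sees the outer coordinate as a phase shift.
Adding 1 makes the integrand nonnegative, so that Tonelli applies at each step. *)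
Lemma integral_cube_1Pcos n (L th : R) (k : nat -> int) : 0 < L ->
  (\int[leb n]_(t in tcube L)
     (1 + cos (th + \sum_(i < n) (pi / L * (k i)%:~R) * tnth t i))%:E =
   ((2 * L) ^+ n * (1 + [forall i : 'I_n, k i == 0]%:R * cos th))%:E)%E.
Proof.
move=> L0; elim: n th k => [|n IH] th k.
  rewrite tcube_tuple0 integral_tuple0; last first.
    by apply/measurable_EFinP; apply: measurable_funD => //; exact: measurable_cos_phase.
  rewrite big_ord0 addr0 expr0 mul1r (_ : [forall i, _] = true) ?mul1r //.
  by apply/forallP => -[].
rewrite tuple_tonelli_cube; first last.
- by move=> t; exact: onePcos_ge0.
- by apply: measurable_funD => //; exact: measurable_cos_phase.
pose b : R := [forall i : 'I_n, k i.+1 == 0]%:R.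
transitivity (\int[@lebesgue_measure R]_(x in `[(- L)%R, L])
    (((2 * L) ^+ n)%:E * (1 + b * cos (th + pi / L * (k 0%N)%:~R * x))%:E))%E.
  apply: eq_integral => x _; rewrite -EFinM -(IH _ (fun i => k i.+1)).
  apply: eq_integral => t _; congr (_ + cos _)%:E.
  rewrite big_ord_recl tnth_tcons0 addrA; congr (_ + _).
  by apply: eq_bigr => i _; rewrite tnth_tconsS.
have cc : measurable_fun [set: R] (fun x : R => 1 + b * cos (th + pi / L * (k 0%N)%:~R * x)).
  apply: measurable_funD => //; apply: measurable_funM => //.
  apply: (measurableT_comp (f := cos)).
    by apply: continuous_measurable_fun; exact: continuous_cos.
  by apply: measurable_funD => //; apply: measurable_funM.
rewrite ge0_integralZl //.
- rewrite integral_segment_1Pcos // -EFinM; congr (_%:E).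
  have -> : [forall i : 'I_n.+1, k i == 0] =
      [forall i : 'I_n, k i.+1 == 0] && (k 0%N == 0).
    apply/forallP/andP => [h|[/forallP h1 h2] i].
      by split; [apply/forallP => i; exact: (h (lift ord0 i))|exact: (h ord0)].
    by case: (unliftP ord0 i) => [j|] -> //=; exact: h1.
  by rewrite exprS -mulnb natrM; ring.
- by apply/measurable_EFinP; apply: measurable_funTS.
- move=> x _; rewrite lee_fin.
  have := onePcos_ge0 (th + pi / L * (k 0%N)%:~R * x).
  have [-> | ->] : b = 1 \/ b = 0 by rewrite /b; case: [forall _, _]; [left|right].
    by rewrite mul1r.
  by rewrite mul0r addr0.
- by rewrite lee_fin exprn_ge0 //; lra.
Qed.

End tuple_functions.

(** * Integrability of the Landau tensor *)

Section kernel.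
Variables (R : realType) (d : nat).
Local Notation mR := (measurableTypeR R).
Local Notation leb := (lebesgue_tuple R).
Implicit Types (z v : 'rV[R]_d) (t : d.-tuple mR).

Definition row_of_tuple t : 'rV[R]_d := \row_i tnth t i.

Lemma row_of_tupleE t i : row_of_tuple t 0 i = tnth t i.
Proof. by rewrite mxE. Qed.

Lemma cube_tcube L : [set t : d.-tuple mR | cube d L (row_of_tuple t)] = tcube L.
Proof.
by apply/seteqP; split=> t /= h i; have := h i; rewrite ?mxE.
Qed.

Lemma enorm_ge0 z : 0 <= enorm z.
Proof. exact: sqrtr_ge0. Qed.

Lemma sqr_enorm z : enorm z ^+ 2 = \sum_i z 0 i ^+ 2.
Proof. by rewrite sqr_sqrtr // sumr_ge0 // => i _; exact: sqr_ge0. Qed.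

Lemma ler_coord_enorm z i : `|z 0 i| <= enorm z.
Proof.
rewrite -(@ler_pXn2r _ 2) ?nnegrE ?enorm_ge0 // sqr_enorm (bigD1 i) //= real_normK ?num_real //.
by rewrite lerDl sumr_ge0 // => j _; exact: sqr_ge0.
Qed.

Lemma enorm_le_sum z : enorm z <= \sum_i `|z 0 i|.
Proof.
rewrite -(@ler_pXn2r _ 2) ?nnegrE ?enorm_ge0 ?sumr_ge0 // sqr_enorm.
rewrite expr2 mulr_suml; apply: ler_sum => i _.
rewrite -real_normK ?num_real // expr2 ler_wpM2l //.
by rewrite (bigD1 i) //= lerDl sumr_ge0.
Qed.

Lemma enorm_cube L z : cube d L z -> enorm z <= d%:R * L.
Proof.
move=> zL; apply: (le_trans (enorm_le_sum z)).
rewrite mulr_natl -[in leRHS](card_ord d) -sumr_const.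
by apply: ler_sum => i _; rewrite ler_norml; exact: zL.
Qed.

Lemma enorm_eq0 z : enorm z = 0 -> z = 0.
Proof.
move=> z0; apply/rowP => i; rewrite mxE; apply/eqP.
by rewrite -normr_le0 -z0 ler_coord_enorm.
Qed.

Lemma measurable_enorm : measurable_fun [set: d.-tuple mR] (fun t => enorm (row_of_tuple t)).
Proof.
rewrite (_ : (fun t => _) = (fun t => (\sum_(i < d) tnth t i ^+ 2) `^ 2^-1)).
  apply: (measurableT_comp (measurable_powR _)).
  apply: measurable_sum => i; apply: measurable_funX; exact: measurable_tnth.
apply/funext => t; rewrite powR12_sqrt ?sumr_ge0// => [|i _]; last exact: sqr_ge0.
by congr Num.sqrt; apply: eq_bigr => i _; rewrite mxE.
Qed.

Lemma landauAE gamma z i j : landauA gamma z i j =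
  enorm z `^ (gamma + 2) * ((i == j)%:R - (enorm z ^+ 2)^-1 * (z 0 i * z 0 j)).
Proof. by rewrite !mxE big_ord1 mxE. Qed.

Lemma measurable_landauA gamma i j :
  measurable_fun [set: d.-tuple mR] (fun t => landauA gamma (row_of_tuple t) i j).
Proof.
rewrite (_ : (fun t => _) = (fun t => enorm (row_of_tuple t) `^ (gamma + 2) *
   ((i == j)%:R - ((enorm (row_of_tuple t)) ^+ 2) `^ (-1) * (tnth t i * tnth t j)))).
  apply: measurable_funM.
    by apply: (measurableT_comp (measurable_powR _)); exact: measurable_enorm.
  apply: measurable_funB => //; apply: measurable_funM.
    apply: (measurableT_comp (measurable_powR _)).
    by apply: measurable_funX; exact: measurable_enorm.
  by apply: measurable_funM; exact: measurable_tnth.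
by apply/funext => t; rewrite landauAE powR_inv1 ?sqr_ge0 // !row_of_tupleE.
Qed.

Lemma landauA_le gamma z i j : `|landauA gamma z i j| <= 2 * enorm z `^ (gamma + 2).
Proof.
rewrite landauAE normrM ger0_norm ?powR_ge0 // mulrC ler_wpM2r ?powR_ge0 //.
apply: (le_trans (ler_normB _ _)); rewrite -[2]/(1 + 1) lerD //.
  by case: (_ == _); rewrite ?normr1 ?normr0.
have [->|z0] := eqVneq (enorm z) 0; first by rewrite expr0n invr0 mul0r normr0.
have zgt0 : 0 < enorm z by rewrite lt_neqAle eq_sym z0 enorm_ge0.
rewrite normrM ger0_norm ?invr_ge0 ?sqr_ge0 // mulrC ler_pdivrMr ?exprn_gt0 // mul1r.
by rewrite normrM expr2 ler_pM // ler_coord_enorm.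
Qed.

(** The exponent gamma + d + 1 is nonnegative, so on the cube this factor is
at most (d L)^(gamma + d + 1); what remains is the critical power 1 - d. *)
Lemma enorm_powR_le gamma L z : - d%:R - 1 <= gamma -> (0 < d)%N -> 0 < L ->
  z != 0 -> cube d L z ->
  enorm z `^ (gamma + 2) <= (d%:R * L) `^ (gamma + d%:R + 1) * (enorm z)^-1 ^+ d.-1.
Proof.
move=> hg d0 L0 z0 zL.
have n0 : enorm z != 0 by apply: contra_neq z0; exact: enorm_eq0.
rewrite (_ : gamma + 2 = (gamma + d%:R + 1) + - (d.-1)%:R); last first.
  by rewrite -subn1 natrB //; ring.
rewrite powRD; last by rewrite n0 implybT.
rewrite ler_pM ?powR_ge0 //.
  have L0' := ltW L0; have h0 : 0 <= gamma + d%:R + 1 by lra.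
  by rewrite ge0_ler_powR ?nnegrE ?enorm_ge0 ?enorm_cube ?mulr_ge0.
by rewrite powRN powR_mulrn ?enorm_ge0 // exprVn.
Qed.

(** The k-th term of a series that dominates |z|^(1 - d) on the cube: it is constant
on the k-th dyadic cube around the origin. *)
Definition dyadic (L : R) (k : nat) t : R :=
  (2 ^+ k.+1 / L) ^+ d.-1 * \1_(tcube (L / 2 ^+ k)) t.

Lemma dyadic_ge0 L k t : 0 < L -> 0 <= dyadic L k t.
Proof.
by move=> L0; rewrite mulr_ge0 // exprn_ge0 // divr_ge0 ?ltW // exprn_gt0.
Qed.

(** For k the last index such that the point lies in the k-th dyadic cube, some
coordinate exceeds L / 2^(k+1), and so does the Euclidean norm. *)
Lemma le_dyadic L t : 0 < L -> tcube L t -> row_of_tuple t != 0 ->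
  exists k, (enorm (row_of_tuple t))^-1 ^+ d.-1 <= dyadic L k t.
Proof.
move=> L0 tL t0.
have n0 : 0 < enorm (row_of_tuple t).
  rewrite lt_neqAle enorm_ge0 andbT eq_sym; apply: contra_neq t0; exact: enorm_eq0.
have ex : exists k, ~~ [forall i, `|tnth t i| <= L / 2 ^+ k].
  (* A nonzero point leaves the dyadic cubes at some stage. *)
  have [i ti] : exists i, tnth t i != 0.
    apply/existsP; apply: contraNT t0; rewrite negb_exists => /forallP h.
    by apply/eqP/rowP => i; rewrite !mxE; apply/eqP; have := h i; rewrite negbK.
  have e0 : 0 < `|tnth t i| / L by rewrite divr_gt0 // normr_gt0.
  have [k _ /(_ k (leqnn k)) /= hk] := near_infty_natSinv_expn_lt (PosNum e0).
  exists k; rewrite negb_forall; apply/existsP; exists i; rewrite -ltNge.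
  by rewrite ltr_pdivlMr // mulrC mulrA mulr1 in hk *.
case: (ex_minnP ex) => -[|k] hk mk.
  move/forallP: hk => []; move=> i; rewrite expr0 divr1 ler_norml; exact: tL.
exists k; rewrite /dyadic indicE mem_set ?mulr1.
  rewrite lerXn2r ?nnegrE ?invr_ge0 ?enorm_ge0 ?divr_ge0 ?(ltW L0) ?exprn_ge0 //.
  have [i hi] : exists i, ~~ (`|tnth t i| <= L / 2 ^+ k.+1) by apply/existsP; rewrite -negb_forall.
  rewrite -ltNge in hi.
  rewrite -[leRHS]invrK lef_pV2 ?posrE ?invr_gt0 ?divr_gt0 ?exprn_gt0 // invf_div.
  by apply: ltW; apply: (lt_le_trans hi); rewrite -row_of_tupleE; exact: ler_coord_enorm.
apply: contrapT => /= h; have : ~~ [forall i, `|tnth t i| <= L / 2 ^+ k].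
  by apply/negP => /forallP h2; apply: h => i; have := h2 i; rewrite ler_norml.
by move/mk; rewrite ltnn.
Qed.

(** The k-th dyadic cube has volume of order 2^(-dk) and carries the value
2^((d-1)k), so that the series is geometric of ratio 1 / 2. *)
Lemma integral_dyadic_lty L : (0 < d)%N -> 0 < L ->
  (\int[leb d]_t (\sum_(0 <= k <oo) (dyadic L k t)%:E) < +oo)%E.
Proof.
move=> d0 L0.
have md k : measurable_fun [set: d.-tuple mR] (fun t => (dyadic L k t)%:E).
  apply/measurable_EFinP; apply: measurable_funM => //.
  by apply: measurable_indic; exact: measurable_tcube.
rewrite integral_nneseries //; last by move=> k t _; rewrite lee_fin dyadic_ge0.
pose c : R := (2 / L) ^+ d.-1 * (2 * L) ^+ d * 2.
apply: (@le_lt_trans _ _ (\sum_(0 <= k <oo) (0 + (c / (2 ^ k.+1)%:R)%:E))%E).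
  apply: lee_nneseries => [k _ _|k _].
    by apply: integral_ge0 => t _; rewrite lee_fin dyadic_ge0.
  rewrite add0e /dyadic; under eq_integral do rewrite EFinM.
  rewrite ge0_integralZl_EFin //; first last.
  - by rewrite exprn_ge0 // divr_ge0 ?ltW // exprn_gt0.
  - by apply/measurable_EFinP/measurable_indic; exact: measurable_tcube.
  rewrite integral_indic // ?setIT; last exact: measurable_tcube.
  have hk : 0 <= L / 2 ^+ k by rewrite divr_ge0 ?(ltW L0) ?exprn_ge0.
  rewrite [X in (_ * X)%E](_ : _ = ((2 * (L / 2 ^+ k)) ^+ d)%:E); last exact: measure_tcube.
  rewrite -EFinM lee_fin.
  rewrite le_eqVlt; apply/orP; left; apply/eqP.
  rewrite /c natrX -(prednK d0) /= !exprS.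
  have -> : 2 * (L / 2 ^+ k) = 2 * L / 2 ^+ k by rewrite mulrA.
  rewrite (_ : 2 * 2 ^+ k / L = 2 / L * 2 ^+ k); last by ring.
  rewrite (exprMn _ _ (2 ^+ k)) (exprMn _ _ (2 ^+ k)^-1) exprVn; field.
  by rewrite !expf_neq0 ?gt_eqF.
have c0 : 0 <= c by rewrite !mulr_ge0 ?exprn_ge0 ?divr_ge0 ?mulr_ge0 ?ltW.
apply: (le_lt_trans (@epsilon_trick _ (fun=> 0%E) c xpredT _ c0)) => //.
by rewrite eseries0 // add0e ltry.
Qed.

Lemma integrable_landauA gamma L i j : - d%:R - 1 <= gamma -> (0 < d)%N -> 0 < L ->
  (leb d).-integrable (tcube L) (fun t => (landauA gamma (row_of_tuple t) i j)%:E).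
Proof.
move=> hg d0 L0; have mA := @measurable_landauA gamma i j.
have mc := @measurable_tcube R d L.
apply/integrableP; split; first by apply/measurable_EFinP; apply: measurable_funTS.
(* The second summand takes care of the origin, where the tensor is at most 2
and the first dyadic term is (2 / L)^(d-1). *)
pose K : R := 2 * ((d%:R * L) `^ (gamma + d%:R + 1) + L ^+ d.-1).
have K0 : 0 < K by rewrite mulr_gt0 // ltr_wpDl ?powR_ge0 ?exprn_gt0.
have md k : measurable_fun [set: d.-tuple mR] (fun t => (dyadic L k t)%:E).
  apply/measurable_EFinP; apply: measurable_funM => //.
  by apply: measurable_indic; exact: measurable_tcube.
have mS : measurable_fun [set: d.-tuple mR]
    (fun t => (\sum_(0 <= k <oo) (dyadic L k t)%:E)%E).
  by apply: ge0_emeasurable_sum => // k t _ _; rewrite lee_fin dyadic_ge0.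
have S0 t : (0 <= \sum_(0 <= k <oo) (dyadic L k t)%:E)%E.
  by apply: nneseries_ge0 => k _ _; rewrite lee_fin dyadic_ge0.
apply: (@le_lt_trans _ _ (\int[leb d]_(t in tcube L)
    (K%:E * \sum_(0 <= k <oo) (dyadic L k t)%:E))%E); last first.
  rewrite ge0_integralZl_EFin //; last 2 first.
  - exact: measurable_funTS.
  - exact: ltW.
  rewrite lte_mul_pinfty ?lee_fin ?(ltW K0) //.
  apply: (le_lt_trans _ (integral_dyadic_lty d0 L0)).
  exact: ge0_subset_integral.
apply: ge0_le_integral => //.
- apply: measurableT_comp => //; apply/measurable_EFinP; exact: measurable_funTS.
- by apply: measurable_funeM; exact: measurable_funTS.
move=> t tL; rewrite abse_EFin.
suff [k hk] : exists k, `|landauA gamma (row_of_tuple t) i j| <= K * dyadic L k t.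
  apply: (@le_trans _ _ (K%:E * (dyadic L k t)%:E)%E).
    by rewrite -EFinM lee_fin.
  rewrite lee_wpmul2l ?lee_fin ?(ltW K0) //.
  have := @nneseries_lim_ge R (fun k => (dyadic L k t)%:E) xpredT 0 k.+1.
  move=> H; apply: le_trans (H _); last by move=> n _ _; rewrite lee_fin dyadic_ge0.
  rewrite big_nat_recr //= leeDr // sume_ge0 // => n _; by rewrite lee_fin dyadic_ge0.
have [t0|t0] := eqVneq (row_of_tuple t) 0.
  exists 0%N; apply: (le_trans (landauA_le _ _ _ _)).
  rewrite /K -mulrA ler_wpM2l // /dyadic expr1 indicE mem_set ?mulr1; last first.
    by rewrite expr0 divr1.
  have L1 : L ^+ d.-1 * (2 / L) ^+ d.-1 = 2 ^+ d.-1.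
    by rewrite -exprMn mulrC divfK ?gt_eqF.
  have h1 : (1 : R) <= 2 ^+ d.-1 by rewrite exprn_ege1 // ler1n.
  have h2 : enorm (row_of_tuple t) `^ (gamma + 2) <= 1.
    rewrite t0 /enorm big1 ?sqrtr0; last by move=> l _; rewrite mxE expr0n.
    by rewrite /powR eqxx; case: (_ == _).
  apply: (le_trans h2); rewrite mulrDl L1.
  by apply: (le_trans h1); rewrite lerDr mulr_ge0 ?powR_ge0 // exprn_ge0 // divr_ge0 // ltW.
have [k hk] := le_dyadic L0 tL t0; exists k.
rewrite (le_trans (landauA_le _ _ _ _)) // /K -mulrA ler_wpM2l //.
apply: (le_trans (enorm_powR_le hg d0 L0 t0 _)); first by rewrite -cube_tcube in tL.
apply: (ler_pM _ _ _ hk); rewrite ?powR_ge0 ?exprn_ge0 ?invr_ge0 ?enorm_ge0 //.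
by rewrite lerDl exprn_ge0 // ltW.
Qed.

End kernel.

(** * Complex modulus, Fourier modes and complex integrals *)

Section complex_facts.
Variable R : realType.
Implicit Types x y z : R[i].

Lemma ReD x y : complex.Re (x + y) = complex.Re x + complex.Re y.
Proof. by case: x y => [a b] [c e]. Qed.

Lemma ImD x y : complex.Im (x + y) = complex.Im x + complex.Im y.
Proof. by case: x y => [a b] [c e]. Qed.

Lemma ReM x y : complex.Re (x * y) = complex.Re x * complex.Re y - complex.Im x * complex.Im y.
Proof. by case: x y => [a b] [c e]. Qed.

Lemma ImM x y : complex.Im (x * y) = complex.Re x * complex.Im y + complex.Im x * complex.Re y.
Proof. by case: x y => [a b] [c e]. Qed.

Lemma complex_ext x y : complex.Re x = complex.Re y -> complex.Im x = complex.Im y -> x = y.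
Proof. by case: x y => [a b] [c e] /= -> ->. Qed.

Lemma cabs_ge0 x : 0 <= cabs x.
Proof. by case: x => a b; exact: sqrtr_ge0. Qed.

Lemma cabs0 : cabs (0 : R[i]) = 0.
Proof. exact: ComplexField.Normc.normc0. Qed.

Lemma cabsD x y : cabs (x + y) <= cabs x + cabs y.
Proof. exact: le_normcD. Qed.

Lemma cabsM x y : cabs (x * y) = cabs x * cabs y.
Proof. exact: ComplexField.Normc.normcM. Qed.

Lemma cabsN x : cabs (- x) = cabs x.
Proof. by case: x => a b; rewrite /cabs /= !sqrrN. Qed.

Lemma cabsB x y : cabs (x - y) <= cabs x + cabs y.
Proof. by rewrite -[cabs y]cabsN; exact: cabsD. Qed.

Lemma cabs_tocplx (a : R) : cabs (tocplx a) = `|a|.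
Proof. by rewrite /cabs /= expr0n addr0 sqrtr_sqr. Qed.

Lemma cabs_sum I (r : seq I) (P : pred I) (h : I -> R[i]) :
  cabs (\sum_(i <- r | P i) h i) <= \sum_(i <- r | P i) cabs (h i).
Proof.
elim/big_ind2 : _ => [|x1 x2 y1 y2 h1 h2|//]; first by rewrite cabs0.
by rewrite (le_trans (cabsD _ _)) // lerD.
Qed.

Lemma Re_le_cabs x : `|complex.Re x| <= cabs x.
Proof.
case: x => a b; rewrite /cabs /= -sqrtr_sqr ler_wsqrtr // lerDl; exact: sqr_ge0.
Qed.

Lemma Im_le_cabs x : `|complex.Im x| <= cabs x.
Proof.
case: x => a b; rewrite /cabs /= -sqrtr_sqr ler_wsqrtr // lerDr; exact: sqr_ge0.
Qed.

Lemma cabs_le_ReIm x : cabs x <= `|complex.Re x| + `|complex.Im x|.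
Proof.
case: x => a b; rewrite /cabs /= -(@ler_pXn2r _ 2) ?nnegrE ?sqrtr_ge0 ?addr_ge0 //.
rewrite sqr_sqrtr ?addr_ge0 ?sqr_ge0 // sqrrD !real_normK ?num_real //.
by rewrite lerD2r lerDl mulrn_wge0 ?mulr_ge0.
Qed.

Lemma tocplxM (a b : R) : tocplx (a * b) = tocplx a * tocplx b.
Proof. by apply: complex_ext; rewrite ?ReM ?ImM /= ?mulr0 ?subr0 ?mul0r ?addr0. Qed.

Lemma tocplxD (a b : R) : tocplx (a + b) = tocplx a + tocplx b.
Proof. by apply: complex_ext; rewrite ?ReD ?ImD /= ?addr0. Qed.

Lemma tocplxN (a : R) : tocplx (- a) = - tocplx a.
Proof. by apply: complex_ext; rewrite /= ?oppr0. Qed.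

Lemma tocplx0 : tocplx (0 : R) = 0. Proof. by []. Qed.
Lemma tocplx1 : tocplx (1 : R) = 1. Proof. by []. Qed.

Lemma cisD (a b : R) : cis (a + b) = cis a * cis b.
Proof.
by apply: complex_ext; rewrite ?ReM ?ImM /= ?cosD ?sinD // addrC.
Qed.

Lemma cabs_cis (a : R) : cabs (cis a) = 1.
Proof. by rewrite /cabs /= cos2Dsin2 sqrtr1. Qed.

End complex_facts.

Section fourier_modes.
Variables (R : realType) (d : nat) (L : R).
Implicit Types (k m : 'rV[int]_d) (v : 'rV[R]_d).

Lemma kdotDl k m v : kdot (k + m) v = kdot k v + kdot m v.
Proof. by rewrite /kdot -big_split; apply: eq_bigr => i _; rewrite !mxE intrD mulrDl. Qed.

Lemma kdotNl k v : kdot (- k) v = - kdot k v.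
Proof. by rewrite /kdot -sumrN; apply: eq_bigr => i _; rewrite !mxE intrN mulNr. Qed.

Lemma kdotDr k v (u : 'rV[R]_d) : kdot k (v + u) = kdot k v + kdot k u.
Proof. by rewrite /kdot -big_split; apply: eq_bigr => i _; rewrite !mxE mulrDr. Qed.

Lemma kdotNr k v : kdot k (- v) = - kdot k v.
Proof. by rewrite /kdot -sumrN; apply: eq_bigr => i _; rewrite !mxE mulrN. Qed.

Lemma fourier_modeD k m v :
  fourier_mode L (k + m) v = fourier_mode L k v * fourier_mode L m v.
Proof. by rewrite /fourier_mode kdotDl mulrDr mulrDl cisD. Qed.

Lemma fourier_modeB k m v :
  fourier_mode L (k - m) v = fourier_mode L k v * cis (- (pi * kdot m v / L)).
Proof. by rewrite /fourier_mode kdotDl kdotNl mulrBr mulrBl cisD. Qed.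

Lemma fourier_mode_shift k v (u : 'rV[R]_d) :
  fourier_mode L k (v + u) = fourier_mode L k v * fourier_mode L k u.
Proof. by rewrite /fourier_mode kdotDr mulrDr mulrDl cisD. Qed.

Lemma cabs_fourier_mode k v : cabs (fourier_mode L k v) = 1.
Proof. exact: cabs_cis. Qed.

Lemma phaseE k (t : d.-tuple (measurableTypeR R)) :
  pi * kdot k (row_of_tuple t) / L = \sum_(i < d) (pi / L * (k 0 i)%:~R) * tnth t i.
Proof.
rewrite /kdot mulr_sumr mulr_suml; apply: eq_bigr => i _; rewrite row_of_tupleE; ring.
Qed.

End fourier_modes.

Section cube_integrals.
Variables (R : realType) (d : nat) (L : R).
Local Notation mR := (measurableTypeR R).
Local Notation leb := (lebesgue_tuple R).
Implicit Types (f g : 'rV[R]_d -> R) (h : 'rV[R]_d -> R[i]) (v : 'rV[R]_d).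

Definition rmeasurable f := measurable_fun [set: d.-tuple mR] (fun t => f (row_of_tuple t)).

Definition cmeasurable h := rmeasurable (fun v => complex.Re (h v)) /\ rmeasurable (fun v => complex.Im (h v)).

Definition rintegrable f :=
  (leb d).-integrable (tcube L) (EFin \o (fun t => f (row_of_tuple t))).

Definition cintegrable h :=
  rintegrable (fun v => complex.Re (h v)) /\ rintegrable (fun v => complex.Im (h v)).

Lemma vint_cubeE f : vint (cube d L) f = \int[leb d]_(t in tcube L) f (row_of_tuple t).
Proof. by rewrite /vint cube_tcube. Qed.

Let mD : measurable (@tcube R d L) := @measurable_tcube R d L.

Lemma rintegrableD f g : rintegrable f -> rintegrable g ->
  rintegrable (fun v => f v + g v).
Proof. by move=> hf hg; exact: (integrableD mD hf hg). Qed.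

Lemma rintegrableZ a f : rintegrable f -> rintegrable (fun v => a * f v).
Proof. by move=> hf; exact: (integrableZl mD a hf). Qed.

Lemma vint_cubeD f g : rintegrable f -> rintegrable g ->
  vint (cube d L) (fun v => f v + g v) = vint (cube d L) f + vint (cube d L) g.
Proof. by move=> hf hg; rewrite !vint_cubeE RintegralD. Qed.

Lemma vint_cubeZ a f : rintegrable f ->
  vint (cube d L) (fun v => a * f v) = a * vint (cube d L) f.
Proof. by move=> hf; rewrite !vint_cubeE RintegralZl. Qed.

Lemma eq_vint_cube f g : (forall v, cube d L v -> f v = g v) ->
  vint (cube d L) f = vint (cube d L) g.
Proof.
move=> fg; rewrite !vint_cubeE; apply: eq_Rintegral => t /set_mem.
by rewrite -cube_tcube => /fg.
Qed.

Lemma eq_rintegrable f g : (forall v, cube d L v -> f v = g v) ->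
  rintegrable f -> rintegrable g.
Proof.
move=> fg; apply: eq_integrable => // t /set_mem.
by rewrite -cube_tcube => /fg /= ->.
Qed.

Lemma eq_cint_cube h1 h2 : (forall v, cube d L v -> h1 v = h2 v) ->
  cint (cube d L) h1 = cint (cube d L) h2.
Proof.
by move=> e; congr (_ +i* _)%C; apply: eq_vint_cube => v /e ->.
Qed.

Lemma eq_cintegrable h1 h2 : (forall v, cube d L v -> h1 v = h2 v) ->
  cintegrable h1 -> cintegrable h2.
Proof.
by move=> e [h h']; split; [apply: eq_rintegrable h|apply: eq_rintegrable h'] => v /e /= ->.
Qed.

Lemma cintegrableD h1 h2 : cintegrable h1 -> cintegrable h2 ->
  cintegrable (fun v => h1 v + h2 v).
Proof.
move=> [a b] [a' b']; split.
  by apply: eq_rintegrable (rintegrableD a a') => v _ /=; rewrite ReD.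
by apply: eq_rintegrable (rintegrableD b b') => v _ /=; rewrite ImD.
Qed.

Lemma cintegrableZ c h : cintegrable h -> cintegrable (fun v => c * h v).
Proof.
move=> [a b]; split.
  apply: eq_rintegrable (rintegrableD (rintegrableZ (complex.Re c) a)
    (rintegrableZ (- complex.Im c) b)) => v _ /=; by rewrite ReM mulNr.
apply: eq_rintegrable (rintegrableD (rintegrableZ (complex.Re c) b)
    (rintegrableZ (complex.Im c) a)) => v _ /=; by rewrite ImM.
Qed.

Lemma cintD h1 h2 : cintegrable h1 -> cintegrable h2 ->
  cint (cube d L) (fun v => h1 v + h2 v) = cint (cube d L) h1 + cint (cube d L) h2.
Proof.
move=> [a b] [a' b']; apply: complex_ext; rewrite ?ReD ?ImD /= -vint_cubeD //;
by apply: eq_vint_cube => v _; rewrite ?ReD ?ImD.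
Qed.

Lemma cintZ c h : cintegrable h ->
  cint (cube d L) (fun v => c * h v) = c * cint (cube d L) h.
Proof.
move=> [a b]; apply: complex_ext; rewrite ?ReM ?ImM /=.
  rewrite -mulNr -!vint_cubeZ // -vint_cubeD; try exact: rintegrableZ.
  by apply: eq_vint_cube => v _; rewrite ReM mulNr.
rewrite -!vint_cubeZ // -vint_cubeD; try exact: rintegrableZ.
by apply: eq_vint_cube => v _; rewrite ImM.
Qed.

Lemma rintegrable0 : rintegrable (fun=> 0).
Proof. by apply: integrable0. Qed.

Lemma cintegrable_sum I (s : seq I) (h : I -> 'rV[R]_d -> R[i]) :
  (forall i, cintegrable (h i)) -> cintegrable (fun v => \sum_(i <- s) h i v).
Proof.
move=> hi; elim: s => [|i s IH].
  by split; apply: eq_rintegrable rintegrable0 => v _ /=; rewrite big_nil.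
apply: eq_cintegrable (cintegrableD (hi i) IH) => v _.
by rewrite big_cons.
Qed.

Lemma cint_sum I (s : seq I) (h : I -> 'rV[R]_d -> R[i]) :
  (forall i, cintegrable (h i)) ->
  cint (cube d L) (fun v => \sum_(i <- s) h i v) = \sum_(i <- s) cint (cube d L) (h i).
Proof.
move=> hi; elim: s => [|i s IH].
  rewrite big_nil.
  have e : vint (cube d L) (fun=> 0) = 0 by rewrite vint_cubeE /Rintegral integral0.
  by rewrite /cint; apply: complex_ext; rewrite /= -[RHS]e; apply: eq_vint_cube => v _;
    rewrite big_nil.
rewrite big_cons -IH -cintD //; last exact: cintegrable_sum.
by apply: eq_cint_cube => v _; rewrite big_cons.
Qed.

Lemma le_vint_cube f g : rintegrable f -> rintegrable g ->
  (forall v, cube d L v -> f v <= g v) -> vint (cube d L) f <= vint (cube d L) g.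
Proof.
move=> hf hg fg; rewrite !vint_cubeE; apply: le_Rintegral => // t.
by rewrite -cube_tcube => /fg.
Qed.

Lemma norm_vint_le f g : rintegrable f -> rintegrable g ->
  (forall v, cube d L v -> `|f v| <= g v) -> `|vint (cube d L) f| <= vint (cube d L) g.
Proof.
move=> hf hg fg; rewrite vint_cubeE.
apply: (le_trans (le_normr_Rintegral mD hf)); rewrite -(vint_cubeE (fun v => `|f v|)).
by apply: le_vint_cube => //; exact: (integrable_norm hf).
Qed.

Lemma cabs_cint_le h g : cintegrable h -> rintegrable g ->
  (forall v, cube d L v -> cabs (h v) <= g v) ->
  cabs (cint (cube d L) h) <= 2 * vint (cube d L) g.
Proof.
move=> [a b] hg hle; apply: (le_trans (cabs_le_ReIm _)) => /=.
rewrite mulr_natl mulr2n; apply: lerD; apply: norm_vint_le => // v vc;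
  by apply: le_trans (hle v vc); rewrite ?Re_le_cabs ?Im_le_cabs.
Qed.

Lemma rmeasurableD f g : rmeasurable f -> rmeasurable g -> rmeasurable (fun v => f v + g v).
Proof. exact: measurable_funD. Qed.

Lemma rmeasurableB f g : rmeasurable f -> rmeasurable g -> rmeasurable (fun v => f v - g v).
Proof. exact: measurable_funB. Qed.

Lemma rmeasurableM f g : rmeasurable f -> rmeasurable g -> rmeasurable (fun v => f v * g v).
Proof. exact: measurable_funM. Qed.

Lemma rmeasurable_cst a : rmeasurable (fun=> a).
Proof. exact: measurable_cst. Qed.

Lemma rmeasurable_continuous f : continuous f -> rmeasurable f.
Proof. exact: measurable_continuous_row. Qed.

Lemma cmeasurableD h1 h2 : cmeasurable h1 -> cmeasurable h2 -> cmeasurable (fun v => h1 v + h2 v).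
Proof.
move=> [a b] [a' b']; split; [move: (rmeasurableD a a')|move: (rmeasurableD b b')];
by under eq_fun do rewrite /= -?ReD -?ImD.
Qed.

Lemma cmeasurableM h1 h2 : cmeasurable h1 -> cmeasurable h2 -> cmeasurable (fun v => h1 v * h2 v).
Proof.
move=> [a b] [a' b']; split.
  by move: (rmeasurableB (rmeasurableM a a') (rmeasurableM b b')); under eq_fun do rewrite /= -ReM.
by move: (rmeasurableD (rmeasurableM a b') (rmeasurableM b a')); under eq_fun do rewrite /= -ImM.
Qed.

Lemma cmeasurable_cst c : cmeasurable (fun=> c).
Proof. by split; exact: rmeasurable_cst. Qed.

Lemma cmeasurable_tocplx f : rmeasurable f -> cmeasurable (fun v => tocplx (f v)).
Proof. by move=> mf; split => //; exact: rmeasurable_cst. Qed.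

Lemma cmeasurable_sum I (s : seq I) (h : I -> 'rV[R]_d -> R[i]) :
  (forall i, cmeasurable (h i)) -> cmeasurable (fun v => \sum_(i <- s) h i v).
Proof.
move=> hi; elim: s => [|i s IH].
  by under eq_fun do rewrite big_nil; exact: cmeasurable_cst.
by under eq_fun do rewrite big_cons; exact: cmeasurableD.
Qed.

Lemma cmeasurable_cis (a : R) k : cmeasurable (fun v => cis (a + pi * kdot k v / L)).
Proof.
have h b : rmeasurable (fun v => cos (b + pi * kdot k v / L)).
  by rewrite /rmeasurable; under eq_fun do rewrite phaseE; exact: measurable_cos_phase.
split; first exact: h.
rewrite /rmeasurable; under eq_fun do rewrite /= -cosBpihalf addrAC.
exact: h.
Qed.

Lemma cmeasurable_mode k : cmeasurable (fourier_mode L k).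
Proof. by have := cmeasurable_cis 0 k; under eq_fun do rewrite add0r. Qed.

Lemma le_rintegrable f g : rmeasurable f -> rintegrable g ->
  (forall v, cube d L v -> `|f v| <= g v) -> rintegrable f.
Proof.
move=> mf hg fg; apply: (le_integrable mD _ _ hg).
  by apply/measurable_EFinP; exact: measurable_funTS.
move=> t; rewrite -cube_tcube => /fg h /=; rewrite lee_fin.
exact: (le_trans h (ler_norm _)).
Qed.

Lemma le_cintegrable h g : cmeasurable h -> rintegrable g ->
  (forall v, cube d L v -> cabs (h v) <= g v) -> cintegrable h.
Proof.
move=> [a b] hg hle; split; apply: (le_rintegrable _ hg) => // v vc /=;
  by apply: le_trans (hle v vc); rewrite ?Re_le_cabs ?Im_le_cabs.
Qed.

Lemma rintegrable_norm f : rintegrable f -> rintegrable (fun v => `|f v|).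
Proof. exact: integrable_norm. Qed.

Hypothesis L0 : 0 < L.

Lemma rintegrable_cst a : rintegrable (fun=> a).
Proof.
apply: (measurable_bounded_integrable mD) => //.
  rewrite [ltLHS](_ : _ = ((2 * L) ^+ d)%:E) ?ltry //.
  by apply: measure_tcube; exact: ltW.
by exists `|a|; split => // x ax t _; exact: ltW.
Qed.

Lemma cintegrable_bounded h B : cmeasurable h ->
  (forall v, cube d L v -> cabs (h v) <= B) -> cintegrable h.
Proof. by move=> mh; apply: le_cintegrable => //; exact: rintegrable_cst. Qed.

Lemma cintegrable_mode k : cintegrable (fourier_mode L k).
Proof.
apply: (@cintegrable_bounded _ 1); first exact: cmeasurable_mode.
by move=> v _; rewrite cabs_fourier_mode.
Qed.

Lemma vint_cos (th : R) k :
  vint (cube d L) (fun v => cos (th + pi * kdot k v / L)) =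
  (2 * L) ^+ d * ((k == 0)%:R * cos th).
Proof.
have ic : rintegrable (fun v => cos (th + pi * kdot k v / L)).
  apply: le_rintegrable (rintegrable_cst 1) _ => //; first exact: (cmeasurable_cis th k).1.
  by move=> v _; exact: cos_max.
have vol : vint (cube d L) (fun=> 1) = (2 * L) ^+ d.
  rewrite vint_cubeE Rintegral_cst // mul1r.
  by rewrite [X in fine X](_ : _ = ((2 * L) ^+ d)%:E) //; exact: measure_tcube (ltW L0).
apply: (@addrI _ ((2 * L) ^+ d)); rewrite -{1}vol -vint_cubeD //; last exact: rintegrable_cst.
(* The frequency as a function on nat, extended by 0. *)
pose kn (i : nat) : int := odflt 0 (omap (k 0) (insub i)).
have knE (i : 'I_d) : kn i = k 0 i by rewrite /kn valK.
transitivity (vint (cube d L) (fun v => 1 + cos (th + pi * kdot k v / L))) => //.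
rewrite vint_cubeE /Rintegral.
transitivity (fine (\int[leb d]_(t in tcube L)
     (1 + cos (th + \sum_(i < d) (pi / L * (kn i)%:~R) * tnth t i))%:E)).
  congr fine; apply: eq_integral => t _; rewrite phaseE.
  by congr (_ + cos (_ + _))%:E; apply: eq_bigr => i _; rewrite knE.
rewrite integral_cube_1Pcos //= mulrDr mulr1; congr (_ + _ * (_%:R * _)); congr nat_of_bool.
apply/forallP/eqP => [h|k0 i]; last by rewrite knE k0 mxE.
by apply/rowP => i; rewrite mxE -knE; apply/eqP; exact: h.
Qed.

Lemma cint_mode k :
  cint (cube d L) (fourier_mode L k) = tocplx ((2 * L) ^+ d) * (k == 0)%:R.
Proof.
have hb : (k == 0)%:R = tocplx ((k == 0)%:R : R) by case: (k == 0).
rewrite hb -tocplxM; apply: complex_ext => /=.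
  by have := vint_cos 0 k; rewrite cos0 mulr1; under eq_fun do rewrite add0r.
have := vint_cos (- (pi / 2)) k; rewrite cosN cos_pihalf !mulr0 => <-.
by congr vint; apply/funext => v; rewrite /= -cosBpihalf addrC.
Qed.

(** Orthogonality in the form in which it is used: coefficients of a finite sum of
modes are read off, also when frequencies repeat. *)
Lemma fourier_coef_sum_mode I (s : seq I) (a : I -> R[i]) (m : I -> 'rV[int]_d) k :
  fourier_coef L (fun v => \sum_(i <- s) a i * fourier_mode L (m i) v) k =
  \sum_(i <- s) a i * (m i == k)%:R.
Proof.
rewrite /fourier_coef.
transitivity (tocplx ((2 * L) ^- d) * cint (cube d L)
    (fun v => \sum_(i <- s) a i * fourier_mode L (m i - k) v)).
  congr (_ * _); apply: eq_cint_cube => v _; rewrite mulr_suml.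
  by apply: eq_bigr => i _; rewrite fourier_modeB mulrA.
rewrite cint_sum => [|i]; last by apply: cintegrableZ; exact: cintegrable_mode.
rewrite mulr_sumr; apply: eq_bigr => i _.
rewrite cintZ ?cint_mode; last exact: cintegrable_mode.
rewrite subr_eq0 mulrCA [tocplx _ * (_ * _)]mulrA -tocplxM mulVf ?tocplx1 ?mul1r //.
by rewrite expf_neq0 // mulf_neq0 ?gt_eqF.
Qed.

End cube_integrals.

(** * Partial derivatives and trigonometric sums *)

Section directional_derivatives.
Variables (R : realType) (d : nat).
Implicit Types (f g : 'rV[R]_d -> R) (h : 'rV[R]_d -> R[i]) (u v : 'rV[R]_d).

(** Reduces partial derivatives to one-variable calculus along a line. *)
Lemma is_derive_line f u v (df : R) :
  is_derive (0 : R) (1 : R) (fun x : R => f (x *: u + v)) df -> is_derive v u f df.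
Proof.
have e : (fun x : R => x^-1 *: (((fun x : R => f (x *: u + v)) \o shift 0) (x *: 1) - f (0 *: u + v)))
   = (fun x => x^-1 *: ((f \o shift v) (x *: u) - f v)).
  by apply/funext => x /=; rewrite addr0 scale0r add0r /GRing.scale /= mulr1.
move=> [h1 h2]; split.
  by move: h1; rewrite /derivable e.
by move: h2; rewrite /derive e.
Qed.

Lemma near_eq_partial f g i v : (\forall x \near v, f x = g x) ->
  partial i f v = partial i g v.
Proof. exact: near_eq_derive. Qed.

Lemma partial_periodic f i u v : (forall x, f (x + u) = f x) ->
  partial i f (v + u) = partial i f v.
Proof.
move=> fu; rewrite /partial /derive fu.
have -> // : f \o shift (v + u) = f \o shift v.
by apply/funext => x /=; rewrite addrA fu.
Qed.

(** Existence of a partial derivative and its value at once, so that the calculus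
rules below can be chained. *)
Definition cderiv h i v (c : R[i]) :=
  is_derive v 'e_i (fun x => complex.Re (h x)) (complex.Re c) /\
  is_derive v 'e_i (fun x => complex.Im (h x)) (complex.Im c).

Lemma cderiv_cgrad h i v c : cderiv h i v c -> cgrad h v 0 i = c.
Proof.
move=> [d1 d2]; rewrite mxE /partial; case: d1 d2 => [_ e1] [_ e2].
by rewrite e1 e2; case: c {e1 e2}.
Qed.

Lemma cderivD h1 h2 i v c1 c2 : cderiv h1 i v c1 -> cderiv h2 i v c2 ->
  cderiv (fun x => h1 x + h2 x) i v (c1 + c2).
Proof.
move=> [d1 d2] [e1 e2]; split; rewrite ?ReD ?ImD; under eq_fun do rewrite ?ReD ?ImD;
  exact: is_deriveD.
Qed.

Lemma cderivZ h i v c (a : R[i]) : cderiv h i v c ->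
  cderiv (fun x => a * h x) i v (a * c).
Proof.
move=> [d1 d2]; split; rewrite ?ReM ?ImM; under eq_fun do rewrite ?ReM ?ImM.
  exact: (is_deriveB (is_deriveZ (complex.Re a) d1) (is_deriveZ (complex.Im a) d2)).
exact: (is_deriveD (is_deriveZ (complex.Re a) d2) (is_deriveZ (complex.Im a) d1)).
Qed.

Lemma cderivB h1 h2 i v c1 c2 : cderiv h1 i v c1 -> cderiv h2 i v c2 ->
  cderiv (fun x => h1 x - h2 x) i v (c1 - c2).
Proof.
move=> d1 d2; have := cderivD d1 (cderivZ (-1) d2).
by rewrite mulN1r; under eq_fun do rewrite mulN1r.
Qed.

Lemma cderiv_cst i v c : cderiv (fun=> c) i v 0.
Proof. by split; exact: is_derive_cst. Qed.

Lemma cderiv_sum I (s : seq I) (h : I -> 'rV[R]_d -> R[i]) i v (c : I -> R[i]) :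
  (forall j, cderiv (h j) i v (c j)) ->
  cderiv (fun x => \sum_(j <- s) h j x) i v (\sum_(j <- s) c j).
Proof.
move=> hc; elim: s => [|j s IH].
  by rewrite big_nil; under eq_fun do rewrite big_nil; exact: cderiv_cst.
by rewrite big_cons; under eq_fun do rewrite big_cons; exact: cderivD.
Qed.

Lemma cderiv_tocplx f i v : derivable f v 'e_i ->
  cderiv (fun x => tocplx (f x)) i v (tocplx (partial i f v)).
Proof.
by move=> df; split; [exact: DeriveDef | exact: is_derive_cst].
Qed.

Lemma kdot_line (k : 'rV[int]_d) i v (x : R) :
  kdot k (x *: 'e_i + v) = x * (k 0 i)%:~R + kdot k v.
Proof.
rewrite kdotDr; congr (_ + _); rewrite /kdot (bigD1 i) //= big1 => [|j ji].
  by rewrite !mxE !eqxx addr0 /= mulr1 mulrC.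
by rewrite !mxE eqxx /= (negbTE ji) !mulr0.
Qed.

Lemma cderiv_mode (L : R) (k : 'rV[int]_d) i v :
  cderiv (fourier_mode L k) i v
    ((0 +i* (pi * (k 0 i)%:~R / L))%C * fourier_mode L k v).
Proof.
set b := pi * (k 0 i)%:~R / L; set p := pi * kdot k v / L.
have e (x : R) : pi * kdot k (x *: 'e_i + v) / L = x * b + p.
  by rewrite kdot_line /b /p; ring.
split; rewrite ?ReM ?ImM /= mul0r ?sub0r ?add0r; apply: is_derive_line => /=;
  under eq_fun do rewrite e; apply: is_derive_eq;
  rewrite mul0r add0r /GRing.scale /= -/p; ring.
Qed.

End directional_derivatives.

Section trigonometric_polynomials.
Variables (R : realType) (d : nat) (L : R).
Implicit Types (v : 'rV[R]_d).

(** Indexing the frequencies of an even cutoff M by finite functions turns sums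
over [KM M] into ordinary finite sums, with product structure. *)
Definition freq (M : nat) (j : {ffun 'I_d -> 'I_M}) : 'rV[int]_d :=
  \row_i ((j i)%:Z - (M./2)%:Z).

Lemma freq_inj M : injective (@freq M).
Proof.
move=> j l e; apply/ffunP => i; apply/val_inj.
by move/rowP: e => /(_ i); rewrite !mxE => /addIr [].
Qed.

Let shift_range (x : int) (m : nat) : - m%:Z <= x -> x <= m%:Z - 1 ->
  (absz (x + m%:Z)%R < m + m)%N /\ (absz (x + m%:Z)%R)%:Z - m%:Z = x.
Proof. by lia. Qed.

Let shift_rangeV (n m : nat) : (n < m + m)%N -> - m%:Z <= n%:Z - m%:Z <= m%:Z - 1.
Proof. by lia. Qed.

Lemma KM_freqP M (k : 'rV[int]_d) : ~~ odd M ->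
  KM M k <-> exists j : {ffun 'I_d -> 'I_M}, k = freq j.
Proof.
move=> oM; have M2 : (M./2 + M./2)%N = M by rewrite addnn halfK (negbTE oM) subn0.
split => [h|[j ->] i]; last first.
  by rewrite mxE; apply: shift_rangeV; rewrite M2.
have lt i : (absz (k ord0 i + (M./2)%:Z)%R < M)%N.
  by have /andP[h1 h2] := h i; rewrite -[X in (_ < X)%N]M2; case: (shift_range h1 h2).
exists [ffun i => Ordinal (lt i)]; apply/rowP => i.
by rewrite mxE ffunE /=; have /andP[h1 h2] := h i; case: (shift_range h1 h2).
Qed.

Lemma finite_KM M : ~~ odd M -> finite_set (@KM d M).
Proof.
move=> oM; rewrite (_ : KM M = [set freq j | j in [set: {ffun 'I_d -> 'I_M}]]).
  by apply: finite_image; exact: finite_finset.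
apply/seteqP; split => k /=; first by move=> /(KM_freqP _ oM)[j ->]; exists j.
by move=> [j _ <-]; apply/KM_freqP => //; exists j.
Qed.

Lemma fsbig_KM (T : Type) (idx : T) (op : Monoid.com_law idx) M (F : 'rV[int]_d -> T) :
  ~~ odd M ->
  \big[op/idx]_(k \in KM M) F k = \big[op/idx]_(j : {ffun 'I_d -> 'I_M}) F (freq j).
Proof.
move=> oM; rewrite (@reindex_fsbig _ _ _ _ _ (@freq M) setT); last first.
  split; first by move=> j _ /=; apply/KM_freqP => //; exists j.
    by move=> j l _ _; exact: freq_inj.
  by move=> k /= /(KM_freqP _ oM)[j ->]; exists j.
rewrite (fsbigE (index_enum _)) ?index_enum_uniq //.
  by apply: eq_bigl => j; rewrite in_setT.
by move=> j _; rewrite mem_index_enum.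
Qed.

(** A finite sum of modes with arbitrary, possibly repeated, frequencies: the flux
of such a sum is again of this form, indexed by pairs. *)
Definition trig_sum (I : finType) (a : I -> R[i]) (m : I -> 'rV[int]_d) v : R[i] :=
  \sum_i a i * fourier_mode L (m i) v.

Lemma trig_polyE M (c : 'rV[int]_d -> R[i]) : ~~ odd M ->
  trig_poly L M c = trig_sum (fun j : {ffun 'I_d -> 'I_M} => c (freq j)) (@freq M).
Proof. by move=> oM; apply/funext => v; rewrite /trig_poly fsbig_KM. Qed.

Lemma fourier_coef_trig_poly M (c : 'rV[int]_d -> R[i]) (k : 'rV[int]_d) : 0 < L -> ~~ odd M ->
  fourier_coef L (trig_poly L M c) k = if `[< KM M k >] then c k else 0.
Proof.
move=> L0 oM; rewrite trig_polyE // fourier_coef_sum_mode //.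
case: asboolP => [/(KM_freqP _ oM)[j ->]|h].
  rewrite (bigD1 j) //= eqxx mulr1 big1 ?addr0 // => l lj.
  by rewrite (inj_eq (@freq_inj M)) (negbTE lj) mulr0.
rewrite big1 // => j _; case: eqP => [e|_]; last by rewrite mulr0.
by exfalso; apply: h; apply/KM_freqP => //; exists j.
Qed.

Lemma proj_trig_sum M (I : finType) (a : I -> R[i]) (m : I -> 'rV[int]_d) v :
  0 < L -> ~~ odd M ->
  Defs.proj L M (trig_sum a m) v =
  \sum_i (if `[< KM M (m i) >] then a i * fourier_mode L (m i) v else 0).
Proof.
move=> L0 oM; rewrite /Defs.proj trig_polyE // /trig_sum.
under eq_bigr do rewrite fourier_coef_sum_mode // mulr_suml.
rewrite exchange_big /=; apply: eq_bigr => i _.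
case: asboolP => [/(KM_freqP _ oM)[j ->]|h].
  rewrite (bigD1 j) //= eqxx mulr1 big1 ?addr0 // => l lj.
  by rewrite (inj_eq (@freq_inj M)) eq_sym (negbTE lj) mulr0 mul0r.
rewrite big1 // => j _; case: eqP => [e|_]; last by rewrite mulr0 mul0r.
by exfalso; apply: h; apply/KM_freqP => //; exists j.
Qed.

Lemma cabs_trig_sum (I : finType) (a : I -> R[i]) (m : I -> 'rV[int]_d) v :
  cabs (trig_sum a m v) <= \sum_i cabs (a i).
Proof.
apply: (le_trans (cabs_sum _ _ _)); apply: ler_sum => i _.
by rewrite cabsM cabs_fourier_mode mulr1.
Qed.

Lemma cderiv_trig_sum (I : finType) (a : I -> R[i]) (m : I -> 'rV[int]_d) i v :
  cderiv (trig_sum a m) i v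
    (trig_sum (fun j => a j * (0 +i* (pi * (m j 0 i)%:~R / L))%C) m v).
Proof.
have := @cderiv_sum R d I (index_enum I) (fun j x => a j * fourier_mode L (m j) x) i v
  (fun j => a j * (0 +i* (pi * (m j 0 i)%:~R / L))%C * fourier_mode L (m j) v).
apply=> j; rewrite -mulrA; apply: cderivZ; exact: cderiv_mode.
Qed.

Lemma cmeasurable_trig_sum (I : finType) (a : I -> R[i]) (m : I -> 'rV[int]_d) :
  cmeasurable (trig_sum a m).
Proof.
by apply: cmeasurable_sum => i; apply: cmeasurableM; [exact: cmeasurable_cst|exact: cmeasurable_mode].
Qed.

End trigonometric_polynomials.

(** * Weighted sums over frequencies *)

Section sums.
Variable R : realType.

Lemma cauchy_schwarz (I : finType) (P : pred I) (x y : I -> R) :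
  (\sum_(i | P i) x i * y i) ^+ 2 <= (\sum_(i | P i) x i ^+ 2) * \sum_(i | P i) y i ^+ 2.
Proof.
rewrite expr2 !mulr_suml.
under eq_bigr do rewrite mulr_sumr.
under [leRHS]eq_bigr do rewrite mulr_sumr.
set A := leLHS; set B := leRHS.
have B2 : B = \sum_(i | P i) \sum_(j | P j) x j ^+ 2 * y i ^+ 2 by rewrite /B exchange_big.
suff : A + A <= B + B by lra.
rewrite {2}B2 /A /B -!big_split /=; apply: ler_sum => i _.
rewrite -!big_split /=; apply: ler_sum => j _.
have := sqr_ge0 (x i * y j - x j * y i); lra.
Qed.

(** Cauchy condensation: the partial sums T satisfy T(2m+1) <= 1 + 2^(1-a) T(m),
hence all stay below the fixed point of x |-> 1 + 2^(1-a) x. *)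
Lemma sum_powR_bounded (a : R) : 1 < a ->
  exists2 B : R, 0 < B & forall m, \sum_(n < m) n.+1%:R `^ (- a) <= B.
Proof.
move=> a1; pose T m : R := \sum_(n < m) n.+1%:R `^ (- a).
pose th : R := 2 * 2 `^ (- a).
(* This is where a > 1 is used. *)
have th1 : th < 1.
  rewrite /th powRN ltr_pdivrMr ?powR_gt0 // mul1r /powR pnatr_eq0 /=.
  by rewrite -[ltLHS]lnK ?posrE // ltr_expR ltr_pMl // ln_gt0 // ltr1n.
have th0 : 0 < th by rewrite mulr_gt0 // powR_gt0.
exists (1 - th)^-1; first by rewrite invr_gt0; lra.
have Tle m l : (m <= l)%N -> T m <= T l.
  move=> ml; rewrite /T -!(big_mkord xpredT (fun n => n.+1%:R `^ (- a))).
  rewrite [leRHS](big_cat_nat (leq0n m) ml) //= lerDl sumr_ge0 // => i _; exact: powR_ge0.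
have rec m : T (m.*2.+1) <= 1 + th * T m.
  elim: m => [|m IH]; first by rewrite /T big_ord1 big_ord0 mulr0 addr0 powR1.
  have -> : T m.+1.*2.+1 = T m.*2.+1 + (m.*2.+2)%:R `^ (- a) + (m.*2.+3)%:R `^ (- a).
    by rewrite doubleS /T [LHS]big_ord_recr /= [in LHS]big_ord_recr.
  have -> : T m.+1 = T m + m.+1%:R `^ (- a) by rewrite /T big_ord_recr.
  have e : th * m.+1%:R `^ (- a) = (m.*2.+2)%:R `^ (- a) + (m.*2.+2)%:R `^ (- a).
    by rewrite /th -mulrA -powRM // -natrM mul2n -doubleS mulr_natl mulr2n.
  have h : (m.*2.+3)%:R `^ (- a) <= (m.*2.+2)%:R `^ (- a).
    rewrite !powRN lef_pV2 ?posrE ?powR_gt0 //.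
    by rewrite ge0_ler_powR ?nnegrE ?ler_nat //; lra.
  by rewrite mulrDr e; lra.
move=> m; rewrite -/(T m).
elim/ltn_ind: m => m IH.
have [m0|m0] := posnP m.
  by rewrite m0 /T big_ord0 invr_ge0; lra.
apply: (@le_trans _ _ (T (m./2.*2.+1))).
  by apply: Tle; lia.
apply: (le_trans (rec _)).
have /IH hm : (m./2 < m)%N by lia.
apply: (@le_trans _ _ (1 + th * (1 - th)^-1)).
  by rewrite lerD2l ler_wpM2l // ltW.
by rewrite le_eqVlt; apply/orP; left; apply/eqP; field; rewrite gt_eqF //; lra.
Qed.

Lemma sum_shift_le (phi : nat -> R) (h : nat) : (forall n, 0 <= phi n) ->
  \sum_(j < h + h) phi (absz (j%:Z - h%:Z)%R) <= phi 0%N + 2 * \sum_(n < h) phi n.+1.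
Proof.
move=> p0; rewrite big_split_ord /=.
have -> : \sum_(i < h) phi (absz (i%:Z - h%:Z)%R) = \sum_(n < h) phi n.+1.
  rewrite (reindex_inj rev_ord_inj) /=; apply: eq_bigr => i _; congr phi.
  by have := ltn_ord i; lia.
have -> : \sum_(i < h) phi (absz ((h + i)%N%:Z - h%:Z)%R) = \sum_(n < h) phi n.
  by apply: eq_bigr => i _; congr phi; lia.
have e1 : \sum_(n < h.+1) phi n = phi 0%N + \sum_(n < h) phi n.+1 by rewrite big_ord_recl.
have e2 : \sum_(n < h.+1) phi n = \sum_(n < h) phi n + phi h by rewrite big_ord_recr.
by have := p0 h; lra.
Qed.

End sums.

Section weights.
Variables (R : realType) (d : nat) (L : R).
Hypotheses (d0 : (0 < d)%N) (L0 : 0 < L).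
Implicit Types k : 'rV[int]_d.

Definition weight k : R := 1 + pi ^+ 2 * ksq R k / L ^+ 2.

Let c : R := pi ^+ 2 / L ^+ 2.

Let c0 : 0 < c.
Proof. by rewrite divr_gt0 // exprn_gt0 // pi_gt0. Qed.

Lemma weightE k : weight k = 1 + \sum_i c * (k 0 i)%:~R ^+ 2.
Proof. by rewrite /weight /ksq mulrAC -/c mulr_sumr. Qed.

Lemma weight_ge_coord k i : 1 + c * (k 0 i)%:~R ^+ 2 <= weight k.
Proof.
rewrite weightE (bigD1 i) //= addrA lerDl sumr_ge0 // => j _.
by rewrite mulr_ge0 ?sqr_ge0 // ltW.
Qed.

Lemma weight_ge1 k : 1 <= weight k.
Proof.
rewrite weightE lerDl sumr_ge0 // => i _; by rewrite mulr_ge0 ?sqr_ge0 // ltW.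
Qed.

Lemma weight_gt0 k : 0 < weight k.
Proof. exact: lt_le_trans (weight_ge1 k). Qed.

Let fac1 (x : R) : 1 <= 1 + c * x ^+ 2.
Proof. by rewrite lerDl mulr_ge0 ?sqr_ge0 // ltW. Qed.

(** Each factor 1 + c k_i^2 is at most the weight, so their product is at most its
d-th power: this splits the sum over frequencies into one-dimensional sums. *)
Lemma weight_powR_le_prod k (sg : R) : 0 <= sg ->
  weight k `^ (- sg) <= \prod_i (1 + c * (k 0 i)%:~R ^+ 2) `^ (- (sg / d%:R)).
Proof.
move=> sg0; have dR : (0 : R) < d%:R by rewrite ltr0n.
have -> : weight k `^ (- sg) = \prod_(i < d) weight k `^ (- (sg / d%:R)).
  rewrite prodr_const card_ord -powR_mulrn ?powR_ge0 // -powRrM; congr (_ `^ _).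
  by field; rewrite gt_eqF.
apply: ler_prod => i _; rewrite powR_ge0 /= !powRN.
have h1 : 0 < 1 + c * (k 0 i)%:~R ^+ 2 by exact: lt_le_trans (fac1 _).
rewrite lef_pV2 ?posrE ?powR_gt0 ?weight_gt0 //
  ge0_ler_powR ?nnegrE ?weight_ge_coord ?(ltW h1) ?(ltW (weight_gt0 _)) //.
by rewrite divr_ge0 // ltW.
Qed.

(** Summability of the weights to the power -sg, for sg > d / 2: by the product
bound the sum is at most the d-th power of a sum over the integers, which behaves like the
convergent series of the n^(-2 sg / d). *)
Lemma sum_weight_bounded (sg : R) : d%:R / 2 < sg ->
  exists2 B : R, 0 < B & forall M, ~~ odd M ->
    \sum_(j : {ffun 'I_d -> 'I_M}) weight (freq j) `^ (- sg) <= B.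
Proof.
move=> hsg; have dR : (0 : R) < d%:R by rewrite ltr0n.
have sg0 : 0 < sg by lra.
pose tau := sg / d%:R.
have tau2 : 1 < 2 * tau by rewrite /tau mulrA ltr_pdivlMr //; lra.
have [B B0 hB] := sum_powR_bounded tau2.
(* 1 for the frequency zero, the rest for the two signs. *)
pose C : R := 1 + 2 * (c `^ (- tau) * B).
have C0 : 0 < C by rewrite /C ltr_wpDr // !mulr_ge0 ?powR_ge0 // ltW.
exists (C ^+ d); first exact: exprn_gt0.
move=> M oM.
pose g (x : nat) : R := (1 + c * x%:R ^+ 2) `^ (- tau).
apply: (@le_trans _ _ (\sum_(j : {ffun 'I_d -> 'I_M})
    \prod_i g (absz ((j i)%:Z - (M./2)%:Z)%R))).
  apply: ler_sum => j _; apply: (le_trans (weight_powR_le_prod _ (ltW sg0))).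
  rewrite le_eqVlt; apply/orP; left; apply/eqP; apply: eq_bigr => i _.
  rewrite /g mxE; congr ((1 + c * _) `^ _).
  by rewrite natr_absz intr_norm real_normK // num_real.
rewrite -(bigA_distr_bigA (fun (i : 'I_d) (j : 'I_M) => g (absz (j%:Z - (M./2)%:Z)%R))) /=.
rewrite prodr_const card_ord; apply: lerXn2r; rewrite ?nnegrE ?(ltW C0) //.
  by apply: sumr_ge0 => i _; exact: powR_ge0.
have M2 : (M./2 + M./2)%N = M by rewrite addnn halfK (negbTE oM) subn0.
have -> : \sum_(j < M) g (absz (j%:Z - (M./2)%:Z)%R) =
    \sum_(j < M./2 + M./2) g (absz (j%:Z - (M./2)%:Z)%R) by rewrite M2.
apply: (le_trans (sum_shift_le _ _)); first by move=> n; exact: powR_ge0.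
rewrite /C lerD //; first by rewrite /g expr0n mulr0 addr0 powR1.
rewrite ler_wpM2l //.
apply: (@le_trans _ _ (\sum_(n < M./2) c `^ (- tau) * n.+1%:R `^ (- (2 * tau)))).
  apply: ler_sum => n _; rewrite /g.
  have x0 : (0 : R) < c * n.+1%:R ^+ 2 by rewrite mulr_gt0 // exprn_gt0.
  have t0 : 0 < tau by lra.
  apply: (@le_trans _ _ ((c * n.+1%:R ^+ 2) `^ (- tau))).
    rewrite !powRN lef_pV2 ?posrE ?powR_gt0 ?addr_gt0 //.
    by rewrite ge0_ler_powR ?nnegrE ?addr_ge0 ?lerDr ?ltW.
  by rewrite powRM ?sqr_ge0 ?(ltW c0) // -(powR_mulrn 2) // -powRrM mulrN.
rewrite -mulr_sumr ler_wpM2l ?powR_ge0 //.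
Qed.

Definition high_freq M (j : {ffun 'I_d -> 'I_M}) : bool :=
  [exists i, (M <= 4 * absz (freq j 0%R i))%N].

(** All these frequencies have weight of order M^2 at least, and there are at most
M^d of them. *)
Lemma sum_weight_high_freq (sg : R) : 0 <= sg ->
  exists2 B : R, 0 < B & forall M, (0 < M)%N ->
    \sum_(j : {ffun 'I_d -> 'I_M} | high_freq j) weight (freq j) `^ (- sg) <=
      B * M%:R `^ (d%:R - 2 * sg).
Proof.
move=> sg0; exists ((c / 16) `^ (- sg)); first by rewrite powR_gt0 // divr_gt0.
move=> M M0; have MR : (0 : R) < M%:R by rewrite ltr0n.
have c16 : 0 < c / 16 by rewrite divr_gt0.
apply: (@le_trans _ _ (\sum_(j : {ffun 'I_d -> 'I_M} | high_freq j)
    ((c / 16) * M%:R ^+ 2) `^ (- sg))).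
  apply: ler_sum => j /existsP[i hi].
  have x0 : 0 < c / 16 * M%:R ^+ 2 by rewrite (mulr_gt0 c16) // exprn_gt0.
  rewrite !powRN lef_pV2 ?posrE ?powR_gt0 ?weight_gt0 //.
  have x1 := ltW x0; have q0 := ltW (weight_gt0 (freq j)).
  rewrite ge0_ler_powR ?nnegrE //.
  apply: le_trans (weight_ge_coord _ i).
  have -> : (freq j 0 i)%:~R ^+ 2 = (absz (freq j 0 i))%:R ^+ 2 :> R.
    by rewrite natr_absz intr_norm real_normK // num_real.
  have h : (M%:R : R) <= 4 * (absz (freq j 0 i))%:R by rewrite -natrM ler_nat.
  have h2 : (M%:R : R) ^+ 2 <= (4 * (absz (freq j 0 i))%:R) ^+ 2.
    by rewrite lerXn2r ?nnegrE ?(ltW MR) // mulr_ge0.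
  have -> : c / 16 * M%:R ^+ 2 = c * (M%:R ^+ 2 / 16) by ring.
  apply: (@le_trans _ _ (c * (absz (freq j 0 i))%:R ^+ 2)); last by rewrite lerDr.
  rewrite ler_pM2l // ler_pdivrMr //; move: h2; rewrite exprMn; lra.
apply: (@le_trans _ _ (\sum_(j : {ffun 'I_d -> 'I_M})
    ((c / 16) * M%:R ^+ 2) `^ (- sg))).
  rewrite [leRHS](bigID (@high_freq M)) /= lerDl sumr_ge0 // => j _; exact: powR_ge0.
have c16' := ltW c16; have MR2 := sqr_ge0 (M%:R : R).
rewrite sumr_const card_ffun !card_ord powRM //.
set K := (c / 16) `^ (- sg).
rewrite -[leLHS]mulr_natr -[leLHS]mulrA ler_wpM2l ?powR_ge0 // natrX.
rewrite -(powR_mulrn d) ?(ltW MR) // -(powR_mulrn 2) ?(ltW MR) // -powRrM -powRD ?(gt_eqF MR) ?implybT //.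
by rewrite le_eqVlt; apply/orP; left; apply/eqP; congr (_ `^ _); ring.
Qed.

(** Cauchy-Schwarz after splitting weight^(1/2) a = weight^((1-s)/2) * weight^(s/2) a. *)
Lemma wiener_le_sobolev (M : nat) (s E B : R) (P : pred {ffun 'I_d -> 'I_M})
    (a : {ffun 'I_d -> 'I_M} -> R) : (forall j, 0 <= a j) ->
  \sum_j weight (freq j) `^ s * a j ^+ 2 <= E ->
  \sum_(j | P j) weight (freq j) `^ (- (s - 1)) <= B ->
  \sum_(j | P j) weight (freq j) `^ 2^-1 * a j <= Num.sqrt (B * E).
Proof.
move=> a0 hE hB.
have sq (x r : R) : (x `^ r) ^+ 2 = x `^ (r * 2) by rewrite powRrM powR_mulrn ?powR_ge0.
have S0 : 0 <= \sum_(j | P j) weight (freq j) `^ 2^-1 * a j.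
  by apply: sumr_ge0 => j _; rewrite mulr_ge0 // powR_ge0.
rewrite -[leLHS]ger0_norm // -sqrtr_sqr ler_wsqrtr //.
have -> : \sum_(j | P j) weight (freq j) `^ 2^-1 * a j =
  \sum_(j | P j) weight (freq j) `^ (- (s - 1) / 2) * (weight (freq j) `^ (s / 2) * a j).
  apply: eq_bigr => j _; rewrite mulrA -powRD ?(gt_eqF (weight_gt0 _)) ?implybT //.
  by congr (_ `^ _ * _); field.
apply: (le_trans (cauchy_schwarz _ _ _)).
apply: ler_pM.
- by apply: sumr_ge0 => j _; exact: sqr_ge0.
- by apply: sumr_ge0 => j _; exact: sqr_ge0.
- apply: le_trans hB; apply: ler_sum => j _.
  by rewrite sq mulrVK ?unitfE.
apply: le_trans hE.
rewrite [leRHS](bigID P) /= -[leLHS]addr0 lerD //.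
  apply: ler_sum => j _.
  by rewrite exprMn sq mulrVK ?unitfE.
by apply: sumr_ge0 => j _; rewrite mulr_ge0 ?powR_ge0 ?sqr_ge0.
Qed.

End weights.

(** * Supremum and Sobolev norms *)

Section sup_norms.
Variables (R : realType) (d : nat).
Implicit Types (g : 'rV[R]_d -> R) (D : set 'rV[R]_d) (v : 'rV[R]_d).

Lemma supn_ge0 D g : (0 <= supn D g)%E.
Proof. by rewrite le_max lexx. Qed.

Lemma le_supn D g v : D v -> ((g v)%:E <= supn D g)%E.
Proof.
by move=> Dv; rewrite le_max; apply/orP; right; apply: ereal_sup_ubound; exists v.
Qed.

Lemma supn_le D g (y : \bar R) : (0 <= y)%E ->
  (forall v, D v -> ((g v)%:E <= y)%E) -> (supn D g <= y)%E.
Proof.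
by move=> y0 h; rewrite ge_max y0 /=; apply: ge_ereal_sup => _ [v Dv <-]; exact: h.
Qed.

Lemma hnorm_ge (z : 'rV[R[i]]_d) i : cabs (z 0 i) <= hnorm z.
Proof.
rewrite -[leLHS]ger0_norm ?cabs_ge0 // -sqrtr_sqr ler_wsqrtr // (bigD1 i) //= lerDl.
by apply: sumr_ge0 => j _; exact: sqr_ge0.
Qed.

Lemma hnorm_le_sum (z : 'rV[R[i]]_d) : hnorm z <= \sum_i cabs (z 0 i).
Proof.
have h := @enorm_le_sum R d (\row_i cabs (z 0 i)); move: h.
rewrite /enorm /hnorm; under eq_bigr do rewrite mxE.
under [X in _ <= X -> _]eq_bigr do rewrite mxE ger0_norm ?cabs_ge0 //.
exact.
Qed.

End sup_norms.

Section sobolev_norm.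
Variables (R : realType) (d : nat) (L s : R).
Hypothesis L0 : 0 < L.
Implicit Types (h : 'rV[R]_d -> R[i]).

Definition sobolev_term h (k : 'rV[int]_d) : R := weight L k `^ s * cabs (fourier_coef L h k) ^+ 2.

Lemma sobolev_term_ge0 h k : 0 <= sobolev_term h k.
Proof. by rewrite mulr_ge0 ?powR_ge0 ?sqr_ge0. Qed.

Lemma Hsnorm_sqr h :
  (Hsnorm L s h ^+ 2 = ((2 * L) ^+ d)%:E * \esum_(k in [set: 'rV[int]_d]) (sobolev_term h k)%:E)%E.
Proof.
have e0 : (0 <= ((2 * L) ^+ d)%:E * \esum_(k in [set: 'rV[int]_d]) (sobolev_term h k)%:E)%E.
  rewrite mule_ge0 ?lee_fin ?exprn_ge0 ?mulr_ge0 ?(ltW L0) //.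
  by apply: esum_ge0 => k _; rewrite lee_fin sobolev_term_ge0.
by rewrite /Hsnorm poweR12_sqrt // sqr_sqrte.
Qed.

Lemma Hsnorm_ge0 h : (0 <= Hsnorm L s h)%E.
Proof. exact: poweR_ge0. Qed.

Lemma sum_sobolev_term_le h (x : R) M : ~~ odd M -> (Hsnorm L s h <= x%:E)%E ->
  \sum_(j : {ffun 'I_d -> 'I_M}) sobolev_term h (freq j) <= x ^+ 2 / (2 * L) ^+ d.
Proof.
move=> oM hx; have V0 : 0 < (2 * L) ^+ d by rewrite exprn_gt0 // mulr_gt0.
rewrite ler_pdivlMr // mulrC -lee_fin.
apply: (@le_trans _ _ (Hsnorm L s h ^+ 2)%E); last first.
  have hfin : Hsnorm L s h \is a fin_num.
    by rewrite ge0_fin_numE ?Hsnorm_ge0 // (le_lt_trans hx) ?ltry.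
  have h0 := Hsnorm_ge0 h; move: h0 hx; rewrite -(fineK hfin) -EFin_expe !lee_fin => h0 hx.
  by rewrite lerXn2r // nnegrE // (le_trans h0).
rewrite Hsnorm_sqr EFinM lee_wpmul2l ?lee_fin ?(ltW V0) //.
apply: esum_ge; exists (@KM d M); last by rewrite fsbig_KM //= sumEFin.
by split => //; exact: finite_KM.
Qed.

(** Finiteness passes from one function to another when their coefficients have the same
moduli outside a finite set of frequencies. *)
Lemma Hsnorm_lty h1 h2 M : ~~ odd M ->
  (forall k, ~ KM M k -> cabs (fourier_coef L h1 k) = cabs (fourier_coef L h2 k)) ->
  (Hsnorm L s h2 < +oo)%E -> (Hsnorm L s h1 < +oo)%E.
Proof.
move=> oM hk h2oo; have V0 : 0 < (2 * L) ^+ d by rewrite exprn_gt0 // mulr_gt0.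
have fK := @finite_KM d M oM.
have es2 : (\esum_(k in [set: 'rV[int]_d]) (sobolev_term h2 k)%:E < +oo)%E.
  have : (Hsnorm L s h2 ^+ 2 < +oo)%E.
    have : Hsnorm L s h2 \is a fin_num by rewrite ge0_fin_numE // Hsnorm_ge0.
    by move=> /fineK <-; rewrite -EFin_expe ltry.
  rewrite Hsnorm_sqr; set X := (\esum_(_ in _) _)%E.
  have [//|e] := ltP X +oo%E.
  by move: e; rewrite leye_eq => /eqP ->; rewrite gt0_muley ?lte_fin // ltxx.
have es1 : (\esum_(k in [set: 'rV[int]_d]) (sobolev_term h1 k)%:E < +oo)%E.
  apply: (@le_lt_trans _ _ (\esum_(k in [set: 'rV[int]_d])
     ((if k \in @KM d M then (sobolev_term h1 k)%:E else 0) + (sobolev_term h2 k)%:E))%E).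
    apply: le_esum => k _; case: ifPn => kM.
      by rewrite leeDl // lee_fin sobolev_term_ge0.
    rewrite add0e lee_fin /sobolev_term hk //.
    by move=> hK; move/negP: kM; apply; exact/mem_set.
  rewrite esumD; last 2 first.
  - by move=> k _; case: ifP => // _; rewrite lee_fin sobolev_term_ge0.
  - by move=> k _; rewrite lee_fin sobolev_term_ge0.
  rewrite -esum_mkcond lte_add_pinfty // esum_fset //; last first.
    by move=> k _; rewrite lee_fin sobolev_term_ge0.
  by rewrite fsbig_KM //= sumEFin ltry.
by apply: poweR_lty; rewrite lte_mul_pinfty ?lee_fin ?(ltW V0).
Qed.

End sobolev_norm.

(** * Periodic extension *)

Section torus_representative.
Variables (R : realType) (L : R).
Hypothesis L0 : 0 < L.
Implicit Type x : R.

Let L2 : 0 < 2 * L.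
Proof. by rewrite mulr_gt0. Qed.

Lemma torus_repr_itv x : - L <= torus_repr L x < L.
Proof.
have /andP[h1 h2] := floor_itv ((x + L) / (2 * L)).
rewrite ler_pdivlMr // in h1; rewrite ltr_pdivrMr // intrD in h2.
by rewrite /torus_repr; apply/andP; split; nra.
Qed.

Lemma torus_repr_id x : - L <= x < L -> torus_repr L x = x.
Proof.
move=> /andP[h1 h2]; rewrite /torus_repr (floor_def (m := 0)) ?mulr0 ?subr0 //.
by rewrite add0r /=; apply/andP; split; [rewrite divr_ge0 //; lra|rewrite ltr_pdivrMr //; lra].
Qed.

Lemma torus_repr_period x (n : int) : torus_repr L (x + 2 * L * n%:~R) = torus_repr L x.
Proof.
rewrite /torus_repr.
have -> : (x + 2 * L * n%:~R + L) / (2 * L) = (x + L) / (2 * L) + n%:~R.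
  by field; rewrite gt_eqF.
by rewrite floorDrz ?intr_int // intrKfloor intrD; ring.
Qed.

End torus_representative.

Section periodic_extension.
Variables (R : realType) (d : nat) (L r : R).
Hypotheses (r0 : 0 < r) (rL : 2 * r < L).
Variable f : 'rV[R]_d -> R.
Hypothesis supp : forall v, f v != 0 -> enorm v < r.
Implicit Types (v x : 'rV[R]_d).

Let L0 : 0 < L.
Proof. by move: r0 rL; lra. Qed.

Lemma supp0 x i : r <= `|x 0 i| -> f x = 0.
Proof.
move=> h; apply/eqP; apply: contraT => /supp hx.
by have := lt_le_trans hx (le_trans h (ler_coord_enorm x i)); rewrite ltxx.
Qed.

(** Up to distance 2L - r from the coordinate hyperplanes, the periodic extension
has not yet met the next copy of the support. *)
Lemma per_ext_near x : (forall i, `|x 0 i| < 2 * L - r) -> per_ext L f x = f x.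
Proof.
move=> hx; rewrite /per_ext.
have [|/forallPn] := boolP [forall i, - L <= x 0 i < L].
  move=> /forallP h; congr f; apply/rowP => i; rewrite mxE; exact: torus_repr_id.
case=> i; rewrite negb_and -ltNge -leNgt => hi.
have -> : f x = 0.
  apply: (@supp0 _ i); rewrite ler_normr.
  by case/orP: hi => hi; apply/orP; [right|left]; (move: r0 rL; lra).
apply: (@supp0 _ i); rewrite mxE.
have := hx i; rewrite ltr_norml => /andP[h1 h2].
case/orP: hi => hi.
  have -> : torus_repr L (x 0 i) = x 0 i + 2 * L.
    rewrite -(torus_repr_period L0 _ 1) mulr1; apply: torus_repr_id => //.
    by apply/andP; split; (move: r0 rL; lra).
  by rewrite ler_normr; apply/orP; left; (move: r0 rL; lra).
have -> : torus_repr L (x 0 i) = x 0 i - 2 * L.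
  rewrite -(torus_repr_period L0 _ (-1)) mulrN1; apply: torus_repr_id => //.
  by apply/andP; split; (move: r0 rL; lra).
by rewrite ler_normr; apply/orP; right; (move: r0 rL; lra).
Qed.

Lemma near_per_ext x : (forall i, `|x 0 i| <= L + r) ->
  \forall y \near x, per_ext L f y = f y.
Proof.
move=> hx; apply/nbhs_ballP; exists (L - 2 * r) => /=; first by (move: r0 rL; lra).
move=> y; case=> _ hy; apply: per_ext_near => i.
have := hy ord0 i; have := hx i; rewrite /ball /= => h1 h2.
have := ler_normB (x ord0 i) (x ord0 i - y ord0 i); rewrite subKr.
by (move: r0 rL; lra).
Qed.

Lemma partial_supp0 x i j : r < `|x 0 i| -> partial j f x = 0.
Proof.
move=> hx; rewrite (@near_eq_partial _ _ _ (fun=> 0)); last first.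
  apply/nbhs_ballP; exists (`|x 0 i| - r) => /=; first by lra.
  move=> y; case=> _ hy; apply: (@supp0 _ i); have := hy ord0 i; rewrite /ball /= => h2.
  have := ler_normD (x ord0 i - y ord0 i) (y ord0 i); rewrite subrK.
  by lra.
by rewrite /partial derive_cst.
Qed.

(** The translation that brings [x] into the fundamental domain. It is used as a
fixed vector, since differentiation commutes with fixed translations. *)
Definition torus_shift x : 'rV[R]_d :=
  \row_i (- (2 * L * (Num.floor ((x 0 i + L) / (2 * L)))%:~R)).

Lemma torus_shiftE x : x + torus_shift x = map_mx (torus_repr L) x.
Proof. by apply/rowP => i; rewrite !mxE. Qed.

Lemma torus_shift_cube x : cube d L (x + torus_shift x).
Proof.
by rewrite torus_shiftE => i; rewrite mxE; have /andP[-> /ltW ->] := torus_repr_itv L0 (x 0 i).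
Qed.

Lemma per_ext_shift x y : per_ext L f (y + torus_shift x) = per_ext L f y.
Proof.
rewrite /per_ext; congr f; apply/rowP => i; rewrite !mxE -mulrN -intrN.
exact: torus_repr_period.
Qed.

Lemma fourier_mode_period k x y :
  fourier_mode L k (y + torus_shift x) = fourier_mode L k y.
Proof.
rewrite fourier_mode_shift; set u := torus_shift x.
have [n hn] : exists n : int, kdot k u = 2 * L * n%:~R.
  exists (\sum_i (k 0 i * - Num.floor ((x 0 i + L) / (2 * L)))).
  rewrite /kdot rmorph_sum mulr_sumr; apply: eq_bigr => i _.
  by rewrite /= mxE intrM intrN; ring.
rewrite /fourier_mode hn.
have -> : pi * (2 * L * n%:~R) / L = pi * n%:~R + pi * n%:~R :> R.
  by field; rewrite gt_eqF.
rewrite [X in _ * X](_ : _ = 1) ?mulr1 //; apply: complex_ext => /=.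
  by rewrite cosD sin_piz mul0r subr0 -expr2 cos2sin2 sin_piz expr0n subr0.
by rewrite sinD sin_piz mul0r mulr0 addr0.
Qed.

End periodic_extension.

(** * The flux of a compactly supported function *)

Section flux_of_supported_function.
Variables (R : realType) (d : nat) (gamma L r : R).
Hypotheses (r0 : 0 < r) (rL : 2 * r < L).
Variable f : 'rV[R]_d -> R.
Hypotheses (sf : smooth f) (supp : forall v, f v != 0 -> enorm v < r).
Local Notation mR := (measurableTypeR R).
Local Notation leb := (lebesgue_tuple R).
Implicit Types (v q : 'rV[R]_d).

(** The nonnegative case applied to the positive and the negative part. *)
Lemma integral_tuple_reflect_signed n (v : nat -> R) (h : n.-tuple mR -> \bar R) :
  measurable_fun [set: n.-tuple mR] h ->
  (\int[leb n]_t h [tuple (v i - tnth t i)%R | i < n] = \int[leb n]_t h t)%E.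
Proof.
move=> mh; rewrite integralE [RHS]integralE; congr (_ - _)%E.
  transitivity (\int[leb n]_t h^\+ [tuple (v i - tnth t i)%R | i < n])%E;
    first by apply: eq_integral => t _; rewrite !funeposE.
  by rewrite (integral_tuple_reflect v (measurable_funepos mh)).
transitivity (\int[leb n]_t h^\- [tuple (v i - tnth t i)%R | i < n])%E;
  first by apply: eq_integral => t _; rewrite !funenegE.
by rewrite (integral_tuple_reflect v (measurable_funeneg mh)).
Qed.

Lemma vint_reflect (H : 'rV[R]_d -> R) v : rmeasurable H ->
  vint setT (fun x => H (v - x)) = vint setT H.
Proof.
move=> mH; pose vn (i : nat) : R := odflt 0 (omap (v 0) (insub i)).
have vnE (i : 'I_d) : vn i = v 0 i by rewrite /vn valK.
have mH' : measurable_fun [set: d.-tuple mR] (fun t => (H (row_of_tuple t))%:E).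
  exact/measurable_EFinP.
rewrite /vint /Rintegral; congr fine.
rewrite -[RHS](integral_tuple_reflect_signed vn mH').
apply: eq_integral => t _; congr (H _)%:E; apply/rowP => i.
by rewrite !mxE tnth_mktuple vnE.
Qed.

Lemma smooth_continuous : continuous f.
Proof. by have [] := sf [::]. Qed.

Lemma smooth_derivable v i : derivable f v 'e_i.
Proof. by have [_] := sf [::]; apply. Qed.

Lemma smooth_partial_continuous i : continuous (partial i f).
Proof. by have [] := sf [:: i]. Qed.

Lemma rmeasurable_comp_sub (g : 'rV[R]_d -> R) v : continuous g -> rmeasurable (fun q => g (v - q)).
Proof.
move=> cg; apply: rmeasurable_continuous => x; apply: continuous_comp; last exact: cg.
by apply: continuousB; [exact: cst_continuous|by move=> ?].
Qed.

Lemma rmeasurable_sum I (s : seq I) (h : I -> 'rV[R]_d -> R) :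
  (forall i, rmeasurable (h i)) -> rmeasurable (fun v => \sum_(i <- s) h i v).
Proof. by move=> mh; apply: measurable_sum => i; exact: mh. Qed.

Definition flux_kernel v i q : R :=
  \sum_l (f (v - q) * partial l f v - f v * partial l f (v - q)) * landauA gamma q l i.

Lemma rmeasurable_flux_kernel v i : rmeasurable (flux_kernel v i).
Proof.
apply: rmeasurable_sum => l; apply: rmeasurableM; last exact: measurable_landauA.
apply: rmeasurableB; apply: rmeasurableM; try exact: rmeasurable_cst.
  by apply: rmeasurable_comp_sub; exact: smooth_continuous.
by apply: rmeasurable_comp_sub; exact: smooth_partial_continuous.
Qed.

(** Substitute q = v - v_*. If q is outside the cube, some coordinate of v - q
exceeds L - r > r in absolute value, so that f and its gradient vanish there. *)
Lemma flux_cubeE v i : enorm v < r ->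
  flux gamma f f v 0 i = vint (cube d L) (flux_kernel v i).
Proof.
move=> vr.
transitivity (vint setT (fun x => flux_kernel v i (v - x))).
  rewrite mxE; congr vint; apply/funext => x; rewrite mxE /flux_kernel subKr.
  by apply: eq_bigr => l _; rewrite !mxE.
rewrite vint_reflect; last exact: rmeasurable_flux_kernel.
rewrite /vint /Rintegral; congr fine; rewrite [RHS]integral_mkcond.
apply: eq_integral => t _; rewrite patchE; case: ifPn => // /negP tc.
have [i0 hi0] : exists i0, ~ (- L <= row_of_tuple t 0 i0 <= L).
  by apply/existsNP => h; apply: tc; exact/mem_set.
have far : r < `|(v - row_of_tuple t) 0 i0|.
  have := ler_coord_enorm v i0; rewrite !mxE; rewrite mxE in hi0; move=> h1.
  have h2 : L < `|tnth t i0|.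
    by rewrite ltNge; apply/negP => h; apply: hi0; rewrite -ler_norml.
  have := ler_normB (v 0 i0) (v 0 i0 - tnth t i0); rewrite subKr.
  by move: rL; lra.
rewrite /flux_kernel big1 // => l _.
rewrite (supp0 supp (ltW far)) (partial_supp0 supp l far).
by rewrite !(mul0r, mulr0, subr0).
Qed.

End flux_of_supported_function.

(** * The periodic flux of a trigonometric sum *)

Section kernel_mass.
Variables (R : realType) (d : nat) (gamma L : R).
Hypotheses (hg : - d%:R - 1 <= gamma) (d0 : (0 < d)%N) (L0 : 0 < L).
Implicit Types (v q : 'rV[R]_d).

Definition landau_col i q : R := \sum_l `|landauA gamma q l i|.

(** The constant through which the tensor enters every estimate. *)
Definition landau_mass : R := \sum_i vint (cube d L) (landau_col i).

Lemma rintegrable_landauA l i : rintegrable L (fun q => landauA gamma q l i).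
Proof. exact: integrable_landauA. Qed.

Lemma rintegrable_sum I (s : seq I) (h : I -> 'rV[R]_d -> R) :
  (forall i, rintegrable L (h i)) -> rintegrable L (fun v => \sum_(i <- s) h i v).
Proof.
move=> hi; elim: s => [|i s IH].
  by apply: eq_rintegrable (@rintegrable0 R d L) => v _ /=; rewrite big_nil.
by apply: eq_rintegrable (rintegrableD (hi i) IH) => v _; rewrite big_cons.
Qed.

Lemma rintegrable_landau_col i : rintegrable L (landau_col i).
Proof.
by apply: rintegrable_sum => l; apply: rintegrable_norm; exact: rintegrable_landauA.
Qed.

Lemma landau_col_ge0 i q : 0 <= landau_col i q.
Proof. exact: sumr_ge0. Qed.

Lemma vint_landau_col_ge0 i : 0 <= vint (cube d L) (landau_col i).
Proof. by apply: Rintegral_ge0 => t _; exact: landau_col_ge0. Qed.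

Lemma vint_landau_col_le i : vint (cube d L) (landau_col i) <= landau_mass.
Proof.
rewrite /landau_mass (bigD1 i) //= lerDl sumr_ge0 // => j _.
exact: vint_landau_col_ge0.
Qed.

Lemma landau_mass_ge0 : 0 <= landau_mass.
Proof. by apply: sumr_ge0 => i _; exact: vint_landau_col_ge0. Qed.

Lemma cabs_kernel_sum (u : 'I_d -> R[i]) (B : R) i q : (forall l, cabs (u l) <= B) ->
  cabs (\sum_l u l * tocplx (landauA gamma q l i)) <= B * landau_col i q.
Proof.
move=> hu; apply: (le_trans (cabs_sum _ _ _)); rewrite mulr_sumr.
by apply: ler_sum => l _; rewrite cabsM cabs_tocplx ler_wpM2r.
Qed.

(** Whatever multiplies the tensor only has to be measurable and bounded. *)
Lemma cint_kernel_le (u : 'I_d -> 'rV[R]_d -> R[i]) (B : R) i :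
  (forall l, cmeasurable (u l)) ->
  (forall l q, cube d L q -> cabs (u l q) <= B) ->
  cintegrable L (fun q => \sum_l u l q * tocplx (landauA gamma q l i)) /\
  cabs (cint (cube d L) (fun q => \sum_l u l q * tocplx (landauA gamma q l i)))
    <= 2 * (B * landau_mass).
Proof.
move=> mu hu.
have bnd q : cube d L q ->
    cabs (\sum_l u l q * tocplx (landauA gamma q l i)) <= B * landau_col i q.
  by move=> qc; apply: cabs_kernel_sum => l; exact: hu.
have iB : rintegrable L (fun q => B * landau_col i q).
  by apply: rintegrableZ; exact: rintegrable_landau_col.
have ic : cintegrable L (fun q => \sum_l u l q * tocplx (landauA gamma q l i)).
  apply: le_cintegrable iB bnd; apply: cmeasurable_sum => l; apply: cmeasurableM => //.
  by apply: cmeasurable_tocplx; exact: measurable_landauA.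
split => //; apply: (le_trans (cabs_cint_le ic iB bnd)); rewrite ler_wpM2l //.
rewrite vint_cubeZ; last exact: rintegrable_landau_col.
have B0 : 0 <= B.
  apply: le_trans (hu (Ordinal d0) 0 _); first exact: cabs_ge0.
  by move=> j; rewrite mxE; apply/andP; split; move: L0; lra.
by rewrite ler_wpM2l // vint_landau_col_le.
Qed.

Lemma flux_perE F v i : flux_per gamma L F F v 0 i =
  cint (cube d L) (fun q => \sum_l
    (F (v - q) * cgrad F v 0 l - F v * cgrad F (v - q) 0 l) *
     tocplx (landauA gamma q l i)).
Proof.
rewrite mxE; apply: eq_cint_cube => q _; rewrite mxE.
by apply: eq_bigr => l _; rewrite !mxE.
Qed.

Section trigonometric_flux.
Variables (I : finType) (a : I -> R[i]) (m : I -> 'rV[int]_d).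
Local Notation F := (trig_sum L a m).

(** The multiplier by which differentiation acts on a mode. *)
Definition mode_factor (k : 'rV[int]_d) (l : 'I_d) : R[i] := (0 +i* (pi * (k 0 l)%:~R / L))%C.

Lemma trig_sum_sub v q : F (v - q) =
  trig_sum L (fun j => a j * fourier_mode L (m j) v) (fun j => - m j) q.
Proof.
apply: eq_bigr => j _; rewrite fourier_mode_shift mulrA; congr (_ * _).
by rewrite /fourier_mode kdotNl kdotNr.
Qed.

Lemma cgrad_trig_sum v l : cgrad F v 0 l = trig_sum L (fun j => a j * mode_factor (m j) l) m v.
Proof. exact: cderiv_cgrad (cderiv_trig_sum L a m l v). Qed.

Lemma cabs_mode_factor k l : cabs (mode_factor k l) <= weight L k `^ 2^-1.
Proof.
rewrite powR12_sqrt ?(ltW (weight_gt0 L0 k)) // /cabs /= expr0n add0r ler_wsqrtr //.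
apply: le_trans (weight_ge_coord L0 k l).
rewrite [leRHS]addrC -[leLHS]addr0 lerD // le_eqVlt; apply/orP; left; apply/eqP.
by field; rewrite gt_eqF.
Qed.

(** The two products of sums are expanded over the same pairs (k, l); only the
difference of their multipliers survives. *)
Lemma flux_integrandE v q l :
  F (v - q) * cgrad F v 0 l - F v * cgrad F (v - q) 0 l =
  \sum_(p : I * I) (a p.1 * a p.2 * fourier_mode L (m p.1 + m p.2) v) *
    ((mode_factor (m p.1) l - mode_factor (m p.2) l) * fourier_mode L (- m p.2) q).
Proof.
rewrite !cgrad_trig_sum.
rewrite (_ : F (v - q) = \sum_k a k * (fourier_mode L (m k) v * fourier_mode L (- m k) q)); last first.
  by rewrite trig_sum_sub; apply: eq_bigr => k _; rewrite mulrA.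
rewrite (_ : trig_sum L _ m (v - q) = \sum_k a k * mode_factor (m k) l *
    (fourier_mode L (m k) v * fourier_mode L (- m k) q)); last first.
  apply: eq_bigr => k _; rewrite fourier_mode_shift; congr (_ * (_ * _)).
  by rewrite /fourier_mode kdotNl kdotNr.
transitivity (\sum_j \sum_k (a j * a k * fourier_mode L (m j + m k) v) *
    ((mode_factor (m j) l - mode_factor (m k) l) * fourier_mode L (- m k) q)); last by rewrite pair_bigA.
rewrite mulrC /trig_sum !mulr_suml -sumrB.
apply: eq_bigr => j _; rewrite !mulr_sumr -sumrB; apply: eq_bigr => k _.
rewrite fourier_modeD; ring.
Qed.

Definition flux_coef i (p : I * I) : R[i] :=
  cint (cube d L) (fun q => \sum_l
    ((mode_factor (m p.1) l - mode_factor (m p.2) l) * fourier_mode L (- m p.2) q) *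
      tocplx (landauA gamma q l i)).

Let cmeasurable_coef p l :
  cmeasurable (fun q => (mode_factor (m p.1) l - mode_factor (m p.2) l) * fourier_mode L (- m p.2) q).
Proof. by apply: cmeasurableM; [exact: cmeasurable_cst|exact: cmeasurable_mode]. Qed.

Let cabs_coef (p : I * I) l q :
  cabs ((mode_factor (m p.1) l - mode_factor (m p.2) l) * fourier_mode L (- m p.2) q) <=
  weight L (m p.1) `^ 2^-1 + weight L (m p.2) `^ 2^-1.
Proof.
rewrite cabsM cabs_fourier_mode mulr1; apply: (le_trans (cabsB _ _)).
by rewrite lerD ?cabs_mode_factor.
Qed.

Lemma cabs_flux_coef i p : cabs (flux_coef i p) <=
  2 * ((weight L (m p.1) `^ 2^-1 + weight L (m p.2) `^ 2^-1) * landau_mass).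
Proof.
exact: (cint_kernel_le i (cmeasurable_coef p) (fun l q _ => cabs_coef p l q)).2.
Qed.

Lemma flux_per_trig_sum i v : flux_per gamma L F F v 0 i =
  trig_sum L (fun p : I * I => a p.1 * a p.2 * flux_coef i p)
    (fun p => m p.1 + m p.2) v.
Proof.
rewrite flux_perE.
transitivity (cint (cube d L) (fun q => \sum_(p : I * I)
   (a p.1 * a p.2 * fourier_mode L (m p.1 + m p.2) v) *
   \sum_l ((mode_factor (m p.1) l - mode_factor (m p.2) l) * fourier_mode L (- m p.2) q) *
      tocplx (landauA gamma q l i))).
  apply: eq_cint_cube => q _.
  under eq_bigr do rewrite flux_integrandE mulr_suml.
  rewrite exchange_big /=; apply: eq_bigr => p _; rewrite mulr_sumr.
  by apply: eq_bigr => l _; rewrite -mulrA.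
have ic p := (cint_kernel_le i (cmeasurable_coef p) (fun l q _ => cabs_coef p l q)).1.
rewrite cint_sum => [|p]; last exact: cintegrableZ.
by apply: eq_bigr => p _; rewrite cintZ // -/(flux_coef i p) mulrAC.
Qed.

(** The periodic flux is itself a finite sum of modes, and projecting it keeps exactly
the pairs (k, l) with k + l in K_M. *)
Lemma flux_trunc_error M i v : ~~ odd M ->
  cabs (flux_per gamma L F F v 0 i - flux_trunc gamma L M F F v 0 i) <=
  \sum_(p : I * I | ~~ `[< KM M (m p.1 + m p.2) >]) cabs (a p.1) * cabs (a p.2) *
    (2 * ((weight L (m p.1) `^ 2^-1 + weight L (m p.2) `^ 2^-1) * landau_mass)).
Proof.
move=> oM; rewrite /flux_trunc [X in _ - X]mxE.
have -> : (fun x => flux_per gamma L F F x 0 i) =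
    trig_sum L (fun p : I * I => a p.1 * a p.2 * flux_coef i p) (fun p => m p.1 + m p.2).
  by apply/funext => x; rewrite flux_per_trig_sum.
rewrite proj_trig_sum // flux_per_trig_sum /trig_sum -sumrB.
rewrite (bigID (fun p : I * I => `[< KM M (m p.1 + m p.2) >])) /= big1 ?add0r; last first.
  by move=> p -> ; rewrite subrr.
apply: (le_trans (cabs_sum _ _ _)); apply: ler_sum => p /negbTE ->.
rewrite subr0 cabsM cabs_fourier_mode mulr1 !cabsM ler_wpM2l ?mulr_ge0 ?cabs_ge0 //.
exact: cabs_flux_coef.
Qed.

End trigonometric_flux.

End kernel_mass.

(** * Comparison of the two fluxes *)

Section comparison.
Variables (R : realType) (d : nat) (gamma L r : R).
Hypotheses (hg : - d%:R - 1 <= gamma) (d0 : (0 < d)%N).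
Hypotheses (r0 : 0 < r) (rL : 2 * r < L).
Variable f : 'rV[R]_d -> R.
Hypotheses (sf : smooth f) (supp : forall v, f v != 0 -> enorm v < r).
Variables (I : finType) (a : I -> R[i]) (m : I -> 'rV[int]_d).
Implicit Types (v q x : 'rV[R]_d).
Local Notation F := (trig_sum L a m).
Local Notation err := (fun x => F x - tocplx (per_ext L f x)).

Let L0 : 0 < L. Proof. by move: r0 rL; lra. Qed.

Lemma trig_sum_period (b : I -> R[i]) x y : trig_sum L b m (y + torus_shift L x) = trig_sum L b m y.
Proof. by apply: eq_bigr => j _; rewrite (fourier_mode_period r0 rL). Qed.

Lemma err_period x y : err (y + torus_shift L x) = err y.
Proof. by rewrite /= trig_sum_period (per_ext_shift r0 rL). Qed.

Lemma cgrad_err_period x y : cgrad err (y + torus_shift L x) = cgrad err y.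
Proof.
apply/rowP => i; rewrite !mxE.
by congr (_ +i* _)%C; apply: partial_periodic => z; rewrite err_period.
Qed.

(** Near such a point the periodic extension coincides with [f], so that it has
the same derivatives. *)
Lemma cgrad_err x l : (forall i, `|x 0 i| <= L + r) ->
  cgrad err x 0 l = cgrad F x 0 l - tocplx (partial l f x).
Proof.
move=> hx; have hn := near_per_ext r0 rL supp hx.
have hd : derivable (per_ext L f) x 'e_l.
  apply: (near_eq_derivable (f := f)); last exact: smooth_derivable.
  by near=> y; apply/esym; near: y.
rewrite cgrad_trig_sum -(near_eq_partial l hn).
exact: cderiv_cgrad (cderivB (cderiv_trig_sum L a m l x) (cderiv_tocplx hd)).
Unshelve. all: end_near.
Qed.

Section bounds.
Variables (W e0 e1 : R).
Hypotheses (FW : forall x, cabs (F x) <= W).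
Hypotheses (FW' : forall x l, cabs (cgrad F x 0 l) <= W).
Hypothesis (hc0 : forall x, cube d L x -> cabs (err x) <= e0).
Hypothesis (hc1 : forall x l, cube d L x -> cabs (cgrad err x 0 l) <= e1).

(** Translate into the fundamental domain, where the hypothesis applies; the
enlarged cube is what v - q ranges over. *)
Lemma err_enlarged_le x : (forall i, `|x 0 i| <= L + r) -> cabs (F x - tocplx (f x)) <= e0.
Proof.
move=> hx; rewrite -(per_ext_near r0 rL supp (x := x)); last first.
  by move=> i; apply: (le_lt_trans (hx i)); move: rL; lra.
have := hc0 (torus_shift_cube r0 rL x); by rewrite err_period.
Qed.

Lemma cgrad_err_enlarged_le x l : (forall i, `|x 0 i| <= L + r) ->
  cabs (cgrad F x 0 l - tocplx (partial l f x)) <= e1.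
Proof.
move=> hx; rewrite -cgrad_err // -(cgrad_err_period x).
by apply: hc1; exact: (torus_shift_cube r0 rL).
Qed.

(** x y - x' y' = x (y - y') + (x - x') y - (x - x') (y - y'): only the
factors x, y and the errors have to be bounded, and the quadratic error is linear in [e]
because e0 <= W. *)
Lemma cabs_mul_diff (x y x' y' : R[i]) (e : R) : cabs x <= W -> cabs y <= W ->
  cabs (x - x') <= e0 -> cabs (y - y') <= e1 -> e0 <= W -> e0 <= e -> e1 <= e ->
  cabs (x * y - x' * y') <= 3 * (W * e).
Proof.
move=> hx hy hx' hy' h1 h2 h3.
have -> : x * y - x' * y' = x * (y - y') + (x - x') * y - (x - x') * (y - y') by ring.
apply: (le_trans (cabsB _ _)).
apply: (@le_trans _ _ (W * e + e * W + W * e)); last by lra.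
apply: lerD; last first.
  by rewrite cabsM ler_pM ?cabs_ge0 ?(le_trans hx') ?(le_trans hy').
apply: (le_trans (cabsD _ _)); apply: lerD;
  by rewrite cabsM ler_pM ?cabs_ge0 ?(le_trans hx') ?(le_trans hy').
Qed.

Definition bracket_trig v l q : R[i] :=
  F (v - q) * cgrad F v 0 l - F v * cgrad F (v - q) 0 l.

Definition bracket_real v l q : R :=
  f (v - q) * partial l f v - f v * partial l f (v - q).

Lemma cmeasurable_bracket_trig v l : cmeasurable (bracket_trig v l).
Proof.
have h : bracket_trig v l = fun q => cgrad F v 0 l *
      trig_sum L (fun j => a j * fourier_mode L (m j) v) (fun j => - m j) q +
    - F v * trig_sum L (fun j => a j * mode_factor L (m j) l * fourier_mode L (m j) v)
      (fun j => - m j) q.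
  apply/funext => q; rewrite /bracket_trig !cgrad_trig_sum !trig_sum_sub mulrC.
  by rewrite mulNr.
by rewrite h; apply: cmeasurableD; apply: cmeasurableM;
  (exact: cmeasurable_cst || exact: cmeasurable_trig_sum).
Qed.

Lemma cmeasurable_bracket_real v l : cmeasurable (fun q => tocplx (bracket_real v l q)).
Proof.
apply: cmeasurable_tocplx; apply: rmeasurableB; apply: rmeasurableM; try exact: rmeasurable_cst.
  by apply: rmeasurable_comp_sub; exact: smooth_continuous.
by apply: rmeasurable_comp_sub; exact: smooth_partial_continuous.
Qed.

Lemma cabs_bracket_trig v l q : cabs (bracket_trig v l q) <= 2 * W ^+ 2.
Proof.
apply: (le_trans (cabsB _ _)); rewrite mulr_natl mulr2n !cabsM expr2.
by rewrite lerD // ler_pM ?cabs_ge0.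
Qed.

Lemma sub_in_enlarged v q : enorm v < r -> cube d L q -> forall i, `|(v - q) 0 i| <= L + r.
Proof.
move=> vr qc i; rewrite !mxE; apply: (le_trans (ler_normB _ _)); rewrite addrC lerD //.
  by rewrite ler_norml; exact: qc.
by apply: (le_trans (ler_coord_enorm v i)); exact: ltW.
Qed.

Lemma self_in_enlarged v : enorm v < r -> forall i, `|v 0 i| <= L + r.
Proof.
move=> vr i; apply: (le_trans (ler_coord_enorm v i)); apply: (le_trans (ltW vr)).
by move: L0; lra.
Qed.

Lemma cabs_bracket_diff v l q (e : R) : enorm v < r -> cube d L q ->
  e0 <= W -> e0 <= e -> e1 <= e ->
  cabs (bracket_trig v l q - tocplx (bracket_real v l q)) <= 6 * (W * e).
Proof.
move=> vr qc h1 h2 h3.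
have vE := self_in_enlarged vr; have qE := sub_in_enlarged vr qc.
rewrite /bracket_trig /bracket_real tocplxD tocplxN !tocplxM.
set X := F (v - q) * _; set Y := F v * _.
set X' := tocplx (f (v - q)) * _; set Y' := tocplx (f v) * _.
have -> : X - Y - (X' - Y') = (X - X') - (Y - Y') by ring.
apply: (le_trans (cabsB _ _)).
have -> : 6 * (W * e) = 3 * (W * e) + 3 * (W * e) by ring.
by apply: lerD; apply: cabs_mul_diff => //;
  rewrite ?err_enlarged_le ?cgrad_err_enlarged_le.
Qed.

Lemma cint_tocplx (D : set 'rV[R]_d) (g : 'rV[R]_d -> R) :
  cint D (fun q => tocplx (g q)) = tocplx (vint D g).
Proof.
apply: complex_ext => //=; rewrite /vint /Rintegral integral0 //.
Qed.

(** Both fluxes are integrals over the same cube against the same tensor, so that only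
the brackets are compared. *)
Lemma flux_diff v i (e : R) : enorm v < r -> e0 <= W -> e0 <= e -> e1 <= e ->
  cabs (flux_per gamma L F F v 0 i - tocplx (flux gamma f f v 0 i)) <=
  2 * (6 * (W * e) * landau_mass d gamma L).
Proof.
move=> vr h1 h2 h3.
have [iT _] := cint_kernel_le hg d0 L0 i (cmeasurable_bracket_trig v)
  (fun l q _ => cabs_bracket_trig v l q).
have mD l : cmeasurable (fun q => bracket_trig v l q - tocplx (bracket_real v l q)).
  have -> : (fun q => bracket_trig v l q - tocplx (bracket_real v l q)) =
      (fun q => bracket_trig v l q + (-1) * tocplx (bracket_real v l q)).
    by apply/funext => q; rewrite mulN1r.
  apply: cmeasurableD; first exact: cmeasurable_bracket_trig.
  by apply: cmeasurableM; [exact: cmeasurable_cst|exact: cmeasurable_bracket_real].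
have [iD bD] := cint_kernel_le hg d0 L0 i mD
  (fun l q qc => cabs_bracket_diff l vr qc h1 h2 h3).
rewrite flux_perE (flux_cubeE gamma rL sf supp i vr) -cint_tocplx.
set D := cint _ _ in bD *; set P := cint (cube d L) _; set X := cint (cube d L) _.
suff -> : X = P - D by rewrite subKr.
rewrite -mulN1r -cintZ // -cintD //; last exact: cintegrableZ.
apply: eq_cint_cube => q _; rewrite mulN1r -sumrB.
rewrite /flux_kernel (big_morph _ (@tocplxD R) (tocplx0 R)).
by apply: eq_bigr => l _; rewrite tocplxM /bracket_trig /bracket_real; ring.
Qed.

Lemma cabs_flux_per_le v i :
  cabs (flux_per gamma L F F v 0 i) <= 2 * (2 * W ^+ 2 * landau_mass d gamma L).
Proof.
rewrite flux_perE.
exact: (cint_kernel_le hg d0 L0 i (cmeasurable_bracket_trig v)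
  (fun l q _ => cabs_bracket_trig v l q)).2.
Qed.

End bounds.

End comparison.

(** * Frequencies removed by the projection *)

Section truncation.
Variables (R : realType) (d : nat).

Let half_sum (x y : int) (h : nat) :
  (4 * absz x < h + h)%N -> (4 * absz y < h + h)%N -> - h%:Z <= x + y <= h%:Z - 1.
Proof. by lia. Qed.

(** Two frequencies with all components below M / 4 have a sum with components
below M / 2. *)
Lemma KM_low_sum M (j l : {ffun 'I_d -> 'I_M}) : ~~ odd M ->
  ~ KM M (freq j + freq l) -> high_freq j || high_freq l.
Proof.
move=> oM; have M2 : (M./2 + M./2)%N = M by rewrite addnn halfK (negbTE oM) subn0.
move=> h; apply: contraT; rewrite negb_or => /andP[hj hl]; exfalso; apply: h => i.
rewrite mxE; apply: half_sum; rewrite M2 ltnNge.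
  by apply: contra hj => hi; apply/existsP; exists i.
by apply: contra hl => hi; apply/existsP; exists i.
Qed.

(** Each removed pair has its first or its second frequency high; each of the two
families sums to the product of a high sum and a full sum. *)
Lemma sum_pairs_high_freq M (x : {ffun 'I_d -> 'I_M} -> R) (W Wh : R) :
  ~~ odd M -> (forall j, 0 <= x j) -> \sum_j x j <= W -> \sum_(j | high_freq j) x j <= Wh ->
  \sum_(p : {ffun 'I_d -> 'I_M} * {ffun 'I_d -> 'I_M} |
      ~~ `[< KM M (freq p.1 + freq p.2) >]) x p.1 * x p.2 <= 2 * (Wh * W).
Proof.
move=> oM x0 hW hWh.
have Wh0 : 0 <= \sum_(j | @high_freq d M j) x j by exact: sumr_ge0.
have W0 : 0 <= \sum_j x j by exact: sumr_ge0.
have xx0 (p : {ffun 'I_d -> 'I_M} * {ffun 'I_d -> 'I_M}) : 0 <= x p.1 * x p.2.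
  by rewrite mulr_ge0.
apply: (@le_trans _ _ (\sum_(p : {ffun 'I_d -> 'I_M} * {ffun 'I_d -> 'I_M})
   ((high_freq p.1)%:R * (x p.1 * x p.2) + (high_freq p.2)%:R * (x p.1 * x p.2)))).
  rewrite big_mkcond; apply: ler_sum => p _; case: ifP => [/asboolPn/(KM_low_sum oM)|_].
    by case: (high_freq p.1); case: (high_freq p.2) => //= _; rewrite ?mul1r ?mul0r ?lerDl ?addr0 ?add0r.
  by rewrite addr_ge0 // mulr_ge0.
have hb (b : bool) (y : R) : b%:R * y = if b then y else 0.
  by case: b; rewrite ?mul1r ?mul0r.
have swap : \sum_(p : {ffun 'I_d -> 'I_M} * {ffun 'I_d -> 'I_M}) (high_freq p.1)%:R * (x p.1 * x p.2) =
   (\sum_(j | high_freq j) x j) * \sum_j x j.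
  rewrite -(pair_bigA _ (fun j l => (high_freq j)%:R * (x j * x l))) /=.
  rewrite [in RHS]big_mkcond [RHS]mulr_suml; apply: eq_bigr => j _.
  by rewrite -mulr_sumr -mulr_sumr hb; case: ifP; rewrite ?mul0r.
have swap2 : \sum_(p : {ffun 'I_d -> 'I_M} * {ffun 'I_d -> 'I_M}) (high_freq p.2)%:R * (x p.1 * x p.2) =
   (\sum_(j | high_freq j) x j) * \sum_j x j.
  rewrite -(pair_bigA _ (fun j l => (high_freq l)%:R * (x j * x l))) /= exchange_big /=.
  rewrite [in RHS]big_mkcond [RHS]mulr_suml; apply: eq_bigr => j _.
  by rewrite -mulr_sumr -mulr_suml hb; case: ifP; rewrite ?mul0r // mulrC.
rewrite big_split /= swap swap2 mulr_natl mulr2n.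
by apply: lerD; rewrite ler_pM.
Qed.

End truncation.

(** * Division by the density *)

Section quotient.
Variable R : realType.

(** The splitting into truncation error, flux error and error in the denominator. *)
Lemma quotient_diff_le (T J : R[i]) (j fv mv kappa t D b e0 : R) :
  0 < kappa -> kappa < fv -> kappa / 2 <= mv -> `|fv - mv| <= e0 ->
  cabs (J - T) <= t -> cabs (J - tocplx j) <= D -> cabs J <= b ->
  cabs (- (tocplx mv^-1 * T) + tocplx (fv^-1 * j)) <=
  2 / kappa * (t + D) + (b + D) * e0 * (2 / kappa ^+ 2).
Proof.
move=> k0 kf km fm hT hj hJ.
have f0 : 0 < fv by lra.
have m0 : 0 < mv by lra.
have -> : - (tocplx mv^-1 * T) + tocplx (fv^-1 * j) =
  tocplx mv^-1 * (J - T) - tocplx mv^-1 * (J - tocplx j) +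
  tocplx j * tocplx (fv^-1 - mv^-1).
  by rewrite tocplxD tocplxN tocplxM; ring.
have mi : mv^-1 <= 2 / kappa.
  by rewrite -[leRHS]invf_div lef_pV2 ?posrE // divr_gt0.
have mi0 : 0 <= mv^-1 by rewrite invr_ge0 ltW.
have t0 : 0 <= t by apply: le_trans hT; exact: cabs_ge0.
apply: (le_trans (cabsD _ _)); apply: lerD.
  apply: (le_trans (cabsB _ _)); rewrite !cabsM cabs_tocplx (ger0_norm mi0) mulrDr.
  by apply: lerD; apply: ler_pM; rewrite ?cabs_ge0.
rewrite cabsM !cabs_tocplx -mulrA; apply: ler_pM => //.
  have : cabs (tocplx j) <= b + D.
    have -> : tocplx j = J - (J - tocplx j) by rewrite subKr.
    by apply: (le_trans (cabsB _ _)); exact: lerD.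
  by rewrite cabs_tocplx.
have -> : fv^-1 - mv^-1 = (mv - fv) / (fv * mv) by field; rewrite !gt_eqF.
have fm0 : 0 <= (fv * mv)^-1 by rewrite invr_ge0 mulr_ge0 // ltW.
rewrite normrM distrC (ger0_norm fm0); apply: ler_pM => //.
rewrite -[leRHS]invf_div lef_pV2 ?posrE ?mulr_gt0 ?divr_gt0 ?exprn_gt0 //; nra.
Qed.

End quotient.

(** * From the Sobolev norm to the coefficients *)

Section coefficients.
Variables (R : realType) (d : nat) (L : R).
Hypothesis L0 : 0 < L.
Implicit Types (h : 'rV[R]_d -> R[i]).

Lemma cintegrable_fourier h B k : cmeasurable h -> (forall v, cube d L v -> cabs (h v) <= B) ->
  cintegrable L (fun v => h v * cis (- (pi * kdot k v / L))).
Proof.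
move=> mh hB; apply: (@cintegrable_bounded _ _ _ L0 _ B).
  apply: cmeasurableM => //; have := cmeasurable_mode L (- k).
  by rewrite /fourier_mode; under eq_fun do rewrite kdotNl mulrN mulNr.
by move=> v vc; rewrite cabsM cabs_cis mulr1; exact: hB.
Qed.

Lemma eq_fourier_coef h1 h2 k : (forall v, cube d L v -> h1 v = h2 v) ->
  fourier_coef L h1 k = fourier_coef L h2 k.
Proof. by move=> e; congr (_ * _); apply: eq_cint_cube => v /e ->. Qed.

Lemma fourier_coefB h1 h2 B1 B2 k : cmeasurable h1 -> cmeasurable h2 ->
  (forall v, cube d L v -> cabs (h1 v) <= B1) ->
  (forall v, cube d L v -> cabs (h2 v) <= B2) ->
  fourier_coef L (fun v => h1 v - h2 v) k = fourier_coef L h1 k - fourier_coef L h2 k.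
Proof.
move=> m1 m2 b1 b2; rewrite /fourier_coef -mulrBr; congr (_ * _).
have i1 := cintegrable_fourier k m1 b1.
have i2 := cintegrable_fourier k m2 b2.
rewrite -mulN1r -cintZ // -cintD //; last exact: cintegrableZ.
by apply: eq_cint_cube => v _; rewrite mulN1r mulrBl.
Qed.

End coefficients.

Lemma cabs_sqr_sum (R : realType) (x y : R[i]) :
  cabs (x + y) ^+ 2 <= 2 * (cabs x ^+ 2 + cabs y ^+ 2).
Proof.
have h := cabsD x y; have := cabs_ge0 (x + y); have := sqr_ge0 (cabs x - cabs y).
by nra.
Qed.

Section sobolev_to_wiener.
Variables (R : realType) (d : nat) (L s : R).
Hypothesis L0 : 0 < L.
Implicit Types (F g : 'rV[R]_d -> R[i]).

(** F is g plus the error, and |x + y|^2 <= 2 (|x|^2 + |y|^2) on each coefficient. *)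
Lemma sobolev_sum_le F g M (x : R) : ~~ odd M ->
  (forall k, fourier_coef L (fun v => F v - g v) k = fourier_coef L F k - fourier_coef L g k) ->
  (Hsnorm L s g <= x%:E)%E -> (Hsnorm L s (fun v => F v - g v)%R <= 1%:E)%E ->
  \sum_(j : {ffun 'I_d -> 'I_M}) weight L (freq j) `^ s * cabs (fourier_coef L F (freq j)) ^+ 2 <=
  2 * (x ^+ 2 + 1) / (2 * L) ^+ d.
Proof.
move=> oM lin hg he.
have h1 := sum_sobolev_term_le L0 oM hg; have h2 := sum_sobolev_term_le L0 oM he.
apply: (@le_trans _ _ (2 * (\sum_(j : {ffun 'I_d -> 'I_M}) sobolev_term L s g (freq j)) +
   2 * \sum_(j : {ffun 'I_d -> 'I_M}) sobolev_term L s (fun v => F v - g v) (freq j))).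
  rewrite !mulr_sumr -big_split /=; apply: ler_sum => j _; rewrite /sobolev_term.
  have := cabs_sqr_sum (fourier_coef L g (freq j)) (fourier_coef L (fun v => F v - g v) (freq j)).
  have -> : fourier_coef L g (freq j) + fourier_coef L (fun v => F v - g v) (freq j) =
      fourier_coef L F (freq j) by rewrite lin addrC subrK.
  move=> hq.
  apply: (le_trans (ler_wpM2l (powR_ge0 _ _) hq)).
  by rewrite le_eqVlt; apply/orP; left; apply/eqP; ring.
rewrite expr1n in h2; have -> : 2 * (x ^+ 2 + 1) / (2 * L) ^+ d =
  2 * (x ^+ 2 / (2 * L) ^+ d) + 2 * (1 / (2 * L) ^+ d) by ring.
by apply: lerD; rewrite ler_wpM2l.
Qed.

End sobolev_to_wiener.

(** * The error of the velocity field *)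

Section velocity_error.
Variables (R : realType) (d : nat) (gamma L r : R).
Hypotheses (hg : - d%:R - 1 <= gamma) (d0 : (0 < d)%N).
Hypotheses (r0 : 0 < r) (rL : 2 * r < L).
Variable f : 'rV[R]_d -> R.
Hypotheses (sf : smooth f) (supp : forall v, f v != 0 -> enorm v < r).
Variables (M : nat) (a : {ffun 'I_d -> 'I_M} -> R[i]).
Hypothesis oM : ~~ odd M.
Implicit Types (v x : 'rV[R]_d).
Local Notation F := (trig_sum L a (@freq d M)).
Local Notation mass := (landau_mass d gamma L).

Let L0 : 0 < L. Proof. by move: r0 rL; lra. Qed.

Variables (W Wh : R).
Hypothesis hW : \sum_j weight L (freq j) `^ 2^-1 * cabs (a j) <= W.
Hypothesis hWh : \sum_(j | high_freq j) weight L (freq j) `^ 2^-1 * cabs (a j) <= Wh.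

Let om_ge1 (k : 'rV[int]_d) : 1 <= weight L k `^ 2^-1.
Proof.
rewrite -[leLHS](powRr0 (weight L k)) ler_powR ?invr_ge0 //; exact: weight_ge1.
Qed.

Lemma cabs_trig_sum_le x : cabs (F x) <= W.
Proof.
apply: le_trans hW; apply: (le_trans (cabs_trig_sum _ _ _ _)).
by apply: ler_sum => j _; rewrite ler_peMl ?cabs_ge0.
Qed.

Lemma cabs_cgrad_trig_sum_le x l : cabs (cgrad F x 0 l) <= W.
Proof.
rewrite cgrad_trig_sum; apply: le_trans hW; apply: (le_trans (cabs_trig_sum _ _ _ _)).
by apply: ler_sum => j _; rewrite cabsM mulrC ler_wpM2r ?cabs_ge0 ?cabs_mode_factor.
Qed.

(** The square roots of the weights are at least 1, so that their sum is at most
twice their product, which distributes over the two Wiener sums. *)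
Lemma flux_trunc_error_le v i :
  cabs (flux_per gamma L F F v 0 i - flux_trunc gamma L M F F v 0 i) <= 8 * (mass * (Wh * W)).
Proof.
have mass0 := landau_mass_ge0 d gamma L.
apply: (le_trans (flux_trunc_error hg d0 L0 a (@freq d M) i v oM)).
pose x j := weight L (freq j) `^ 2^-1 * cabs (a j).
apply: (@le_trans _ _ (\sum_(p : {ffun 'I_d -> 'I_M} * {ffun 'I_d -> 'I_M} |
    ~~ `[< KM M (freq p.1 + freq p.2) >]) 4 * mass * (x p.1 * x p.2))).
  apply: ler_sum => p _; rewrite /x.
  have := om_ge1 (freq p.1); have := om_ge1 (freq p.2).
  set w1 := weight L (freq p.1) `^ _; set w2 := weight L (freq p.2) `^ _ => w21 w11.
  have c0 : 0 <= cabs (a p.1) * cabs (a p.2) * mass by rewrite !mulr_ge0 ?cabs_ge0.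
  have -> : 4 * mass * (w1 * cabs (a p.1) * (w2 * cabs (a p.2))) =
    (cabs (a p.1) * cabs (a p.2) * mass) * (4 * (w1 * w2)) by ring.
  have -> : cabs (a p.1) * cabs (a p.2) * (2 * ((w1 + w2) * mass)) =
    (cabs (a p.1) * cabs (a p.2) * mass) * (2 * (w1 + w2)) by ring.
  by rewrite ler_wpM2l //; nra.
rewrite -mulr_sumr.
have x0 j : 0 <= x j by rewrite mulr_ge0 ?powR_ge0 ?cabs_ge0.
have -> : 8 * (mass * (Wh * W)) = 4 * mass * (2 * (Wh * W)) by ring.
rewrite ler_wpM2l ?mulr_ge0 //; exact: sum_pairs_high_freq.
Qed.

Variables (kappa fl e0 e1 e : R).
Hypotheses (k0 : 0 < kappa) (hfl : fl <= kappa / 2).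
Hypotheses (e0k : e0 <= kappa / 2) (e0e : e0 <= e) (e1e : e1 <= e).
Local Notation err := (fun x => F x - tocplx (per_ext L f x)).
Hypothesis hc0 : forall x, cube d L x -> cabs (err x) <= e0.
Hypothesis hc1 : forall x l, cube d L x -> cabs (cgrad err x 0 l) <= e1.

(** The pointwise estimate in terms of Wiener sums. Both
kappa <= 2 W and e0 <= W hold because |F(v)| >= kappa / 2; they turn the terms
that are linear in 1 / kappa or quadratic in the error into multiples of e / kappa^2. *)
Lemma velocity_error_le v : kappa < f v ->
  hnorm (velocity_trunc gamma L M fl F v - vtocplx (velocity gamma f v)) <=
  d%:R * (16 * (mass * (Wh * W)) / kappa + 80 * (W ^+ 2 * mass) * e / kappa ^+ 2).
Proof.
move=> kf.
have mass0 := landau_mass_ge0 d gamma L.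
have vr : enorm v < r by apply: supp; rewrite gt_eqF // (lt_trans k0).
have vE := self_in_enlarged r0 rL vr.
have errv := err_enlarged_le r0 rL supp hc0 vE.
have FvW := cabs_trig_sum_le v.
have Re_err : `|f v - complex.Re (F v)| <= e0.
  rewrite distrC; apply: le_trans errv.
  by have := Re_le_cabs (F v - tocplx (f v)); rewrite ReD.
have ReF : kappa / 2 <= complex.Re (F v).
  by move: Re_err e0k kf; rewrite ler_norml => /andP[]; lra.
have mE : Num.max (complex.Re (F v)) fl = complex.Re (F v).
  by apply/max_idPl; apply: le_trans ReF.
have kW : kappa / 2 <= W.
  apply: (le_trans ReF); apply: (le_trans (ler_norm _)).
  exact: (le_trans (Re_le_cabs _) FvW).
have e0W : e0 <= W by apply: le_trans kW.
have e00 : 0 <= e0 by apply: le_trans errv; exact: cabs_ge0.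
apply: (le_trans (hnorm_le_sum _)); set Y := (X in d%:R * X).
have -> : d%:R * Y = \sum_(i < d) Y by rewrite sumr_const card_ord mulr_natl.
apply: ler_sum => i _.
have entryE (c : R[i]) (T : 'rV[R[i]]_d) (c' : R) (j : 'rV[R]_d) :
    (- (c *: T) - vtocplx (- (c' *: j))) 0 i = - (c * T 0 i) + tocplx (c' * j 0 i).
  by rewrite !mxE tocplxN opprK.
rewrite /velocity_trunc /velocity entryE mE.
apply: (le_trans (quotient_diff_le k0 kf ReF Re_err (flux_trunc_error_le v i)
  (flux_diff hg d0 r0 rL sf supp cabs_trig_sum_le cabs_cgrad_trig_sum_le hc0 hc1 i vr e0W e0e e1e)
  (cabs_flux_per_le hg d0 r0 rL cabs_trig_sum_le cabs_cgrad_trig_sum_le v i))).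
set X := mass * (Wh * W).
have W0 : 0 <= W by apply: le_trans e0W.
have e_ge0 : 0 <= e by apply: le_trans e0e.
have mW0 : 0 <= mass * W by rewrite mulr_ge0.
have k2 : 0 <= (kappa ^+ 2)^-1 by rewrite invr_ge0 sqr_ge0.
have -> : 2 / kappa * (8 * X + 2 * (6 * (W * e) * mass)) =
   16 * X / kappa + (24 * (mass * W * (e * kappa))) / kappa ^+ 2.
  by field; rewrite gt_eqF.
rewrite /Y -/X -addrA lerD2l.
have -> : (2 * (2 * W ^+ 2 * mass) + 2 * (6 * (W * e) * mass)) * e0 * (2 / kappa ^+ 2) =
  (8 * (mass * W * (W * e0)) + 24 * (mass * W * (e * e0))) / kappa ^+ 2 by ring.
rewrite -mulrDl ler_wpM2r //.
have -> : 80 * (W ^+ 2 * mass) * e = 80 * (mass * W * (W * e)) by ring.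
have i1 : mass * W * (e * kappa) <= mass * W * (2 * (W * e)).
  by rewrite ler_wpM2l //; nra.
have i2 : mass * W * (W * e0) <= mass * W * (W * e).
  by rewrite ler_wpM2l // ler_wpM2l.
have i3 : mass * W * (e * e0) <= mass * W * (W * e).
  by rewrite ler_wpM2l // [leRHS]mulrC ler_wpM2l.
by lra.
Qed.

End velocity_error.

Theorem theorem3p1 (R : realType) (d : nat) (gamma r L s : R)
    (hd : (2 <= d)%N)
    (hgamma : - d%:R - 1 <= gamma <= 1)
    (hr : 0 < r) (hL : 2 * r < L) (hs : d%:R / 2 + 1 < s) :
  exists C : \bar R -> R, (forall x, 0 < C x) /\
  forall f : 'rV[R]_d -> R,
    smooth f ->
    (forall v, f v != 0 -> enorm v < r) ->
  forall (N : nat) (w : 'I_N -> R) (p : 'I_N -> 'rV[R]_d)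
    (M : nat) (kappa fl : R),
    (1 <= N)%N ->
    (forall i, 0 < w i) ->
    \sum_(i < N) w i = 1 ->
    (2 <= M)%N -> ~~ odd M ->
    0 < kappa -> 0 < fl -> fl <= kappa / 2 ->
  let fMN := empirical_proj L M w p in
  let f_per := fun v => tocplx (per_ext L f v) in
  let err := fun v => fMN v - f_per v in
  let Omega := [set v | kappa < f v] in
    (C0norm (cube d L) err <= (kappa / 2)%:E)%E ->
    (Hsnorm L s err <= 1%:E)%E ->
    (C0vnorm Omega (fun v =>
        velocity_trunc gamma L M fl fMN v - vtocplx (velocity gamma f v))%R
     <= (C (Hsnorm L s f_per))%:E *
        ((kappa^-1 * M%:R `^ (- (s - d%:R / 2 - 1)))%:E +
         ((kappa ^+ 2)^-1)%:E * C1norm (cube d L) err))%E.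
Proof.
have d0 : (0 < d)%N by exact: ltnW.
have hg : - d%:R - 1 <= gamma by case/andP: hgamma.
have L0 : 0 < L by lra.
have hsg : d%:R / 2 < s - 1 by lra.
have sg0 : 0 <= s - 1 by apply: le_trans (ltW hsg); rewrite divr_ge0.
have [B1 B10 hB1] := sum_weight_bounded d0 L0 hsg.
have [B2 B20 hB2] := sum_weight_high_freq d L0 sg0.
set mass := landau_mass d gamma L.
have mass0 : 0 <= mass := landau_mass_ge0 d gamma L.
(* E bounds the square of the weighted l^2 norm of the coefficients of F, the
summand 1 coming from the Sobolev norm of the error; W bounds the Wiener norm of F, and V times the
rate in M the part of it at high frequencies. *)
pose E (x : \bar R) : R := 2 * (fine x ^+ 2 + 1) / (2 * L) ^+ d.
pose W x : R := Num.sqrt (B1 * E x).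
pose V x : R := Num.sqrt (B2 * E x).
have W0 x : 0 <= W x by exact: sqrtr_ge0.
have V0 x : 0 <= V x by exact: sqrtr_ge0.
have E0 x : 0 <= E x.
  by rewrite divr_ge0 ?exprn_ge0 ?mulr_ge0 ?addr_ge0 ?sqr_ge0 // ltW.
exists (fun x => d%:R * (16 * (mass * (V x * W x)) + 80 * (W x ^+ 2 * mass)) + 1).
split=> [x|].
  by rewrite ltr_wpDl // mulr_ge0 // addr_ge0 // !mulr_ge0 // exprn_ge0.
move=> f sf supp N w p M kappa fl _ _ _ M2 oM k0 _ hfl fMN f_per err Omega hC0 hHs.
pose a (j : {ffun 'I_d -> 'I_M}) := empirical_coef L w p (freq j).
have FE : fMN = trig_sum L a (@freq d M) by rewrite /fMN /empirical_proj trig_polyE.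
have hC0v v : cube d L v -> cabs (err v) <= kappa / 2.
  by move=> vc; rewrite -lee_fin; apply: le_trans hC0; exact: le_supn.
have f_perE v : cube d L v -> f_per v = tocplx (f v).
  move=> vc; congr tocplx; apply: (per_ext_near hr hL supp) => i.
  by have := vc i; rewrite -ler_norml; lra.
have FB v : cabs (fMN v) <= \sum_j cabs (a j) by rewrite FE; exact: cabs_trig_sum.
have lin k : fourier_coef L err k = fourier_coef L fMN k - fourier_coef L f_per k.
  (* On the cube the extension may be replaced by the continuous function f. *)
  rewrite (eq_fourier_coef (L := L) (h1 := f_per) k f_perE).
  rewrite (eq_fourier_coef (L := L) (h1 := err) (h2 := fun v => fMN v - tocplx (f v)) k); last first.
    by move=> v /f_perE; rewrite /err => ->.
  apply: (@fourier_coefB _ _ _ L0 _ _ (\sum_j cabs (a j)) (\sum_j cabs (a j) + kappa / 2)).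
  - by rewrite FE; exact: cmeasurable_trig_sum.
  - by apply: cmeasurable_tocplx; apply: rmeasurable_continuous; exact: smooth_continuous.
  - by move=> v _; exact: FB.
  move=> v vc; rewrite -f_perE //.
  have -> : f_per v = fMN v - err v by rewrite /err subKr.
  by apply: (le_trans (cabsB _ _)); rewrite lerD ?hC0v.
have coefF k : fourier_coef L fMN k = if `[< KM M k >] then empirical_coef L w p k else 0.
  exact: fourier_coef_trig_poly.
set x := Hsnorm L s f_per.
(* Outside K_M the coefficients of f and of the error agree up to sign. *)
have xfin : x \is a fin_num.
  rewrite ge0_fin_numE ?Hsnorm_ge0 //.
  apply: (Hsnorm_lty L0 oM (h2 := err)); last by apply: le_lt_trans hHs _; rewrite ltry.
  by move=> k /asboolPn/negbTE kM; rewrite lin coefF kM sub0r cabsN.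
have hE : \sum_(j : {ffun 'I_d -> 'I_M}) weight L (freq j) `^ s * cabs (a j) ^+ 2 <= E x.
  have := sobolev_sum_le L0 oM lin _ hHs (x := fine x); rewrite fineK // => /(_ (lexx _)).
  apply: le_trans; rewrite le_eqVlt; apply/orP; left; apply/eqP.
  apply: eq_bigr => j _; rewrite coefF ifT //; apply/asboolP/KM_freqP => //; by exists j.
have a0 j : 0 <= cabs (a j) by exact: cabs_ge0.
have hW : \sum_j weight L (freq j) `^ 2^-1 * cabs (a j) <= W x.
  exact: (wiener_le_sobolev L0 (P := xpredT) a0 hE (hB1 M oM)).
pose rate := M%:R `^ (- (s - d%:R / 2 - 1)) : R.
have M0 : (0 < M)%N by exact: ltnW.
have hWh : \sum_(j | high_freq j) weight L (freq j) `^ 2^-1 * cabs (a j) <= V x * rate.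
  apply: (le_trans (wiener_le_sobolev L0 a0 hE (hB2 M M0))).
  have be0 : 0 <= B2 * E x by rewrite mulr_ge0 // ltW.
  rewrite mulrAC (sqrtrM _ be0) -(powR12_sqrt (powR_ge0 _ _)) -powRrM.
  by rewrite le_eqVlt; apply/orP; left; apply/eqP; congr (_ * _ `^ _); field.
have rate0 : 0 <= rate by exact: powR_ge0.
pose C : R := d%:R * (16 * (mass * (V x * W x)) + 80 * (W x ^+ 2 * mass)) + 1.
change (C0vnorm Omega (fun v =>
    velocity_trunc gamma L M fl fMN v - vtocplx (velocity gamma f v))%R <=
  C%:E * ((kappa^-1 * rate)%:E + ((kappa ^+ 2)^-1)%:E * C1norm (cube d L) err))%E.
have C_gt0 : 0 < C by rewrite ltr_wpDl // mulr_ge0 // addr_ge0 // !mulr_ge0 // exprn_ge0.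
have n0 : (0 <= C0norm (cube d L) err)%E by exact: supn_ge0.
have n1 : (0 <= C0vnorm (cube d L) (cgrad err))%E by exact: supn_ge0.
have k2 : 0 < (kappa ^+ 2)^-1 by rewrite invr_gt0 exprn_gt0.
(* An infinite C^1 norm makes the right-hand side infinite. *)
have [C1oo|C1fin] := eqVneq (C1norm (cube d L) err) +oo%E.
  by rewrite C1oo gt0_muley ?lte_fin // addey // gt0_muley ?lte_fin // leey.
have : C1norm (cube d L) err \is a fin_num.
  by rewrite ge0_fin_numE ?ltey ?adde_ge0.
rewrite /C1norm fin_numD => /andP[f0 f1].
set n0' := C0norm _ _ in n0 f0 *; set n1' := C0vnorm _ (cgrad _) in n1 f1 *.
pose e0 := fine n0'; pose e1 := fine n1'.
have e0E : n0' = e0%:E by rewrite fineK.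
have e1E : n1' = e1%:E by rewrite fineK.
have e00 : 0 <= e0 by exact: fine_ge0.
have e10 : 0 <= e1 by exact: fine_ge0.
have e0k : e0 <= kappa / 2 by rewrite -lee_fin -e0E.
have hc0 v : cube d L v -> cabs (err v) <= e0.
  by move=> vc; rewrite -lee_fin -e0E; exact: le_supn.
have hc1 v l : cube d L v -> cabs (cgrad err v 0 l) <= e1.
  move=> vc; apply: (le_trans (hnorm_ge _ _)); rewrite -lee_fin -e1E; exact: le_supn.
have -> : (n0' + n1' = (e0 + e1)%:E)%E by rewrite e0E e1E.
change (C0vnorm Omega (fun v =>
    velocity_trunc gamma L M fl fMN v - vtocplx (velocity gamma f v))%R <=
  (C * (kappa^-1 * rate + (kappa ^+ 2)^-1 * (e0 + e1)))%:E)%E.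
have tot0 : 0 <= kappa^-1 * rate + (kappa ^+ 2)^-1 * (e0 + e1).
  by rewrite addr_ge0 // mulr_ge0 ?addr_ge0 ?(ltW k2) // invr_ge0 ltW.
apply: supn_le; first by rewrite lee_fin mulr_ge0 ?(ltW C_gt0).
move=> v vO; rewrite lee_fin.
have errE : err = fun x => trig_sum L a (@freq d M) x - tocplx (per_ext L f x).
  by apply/funext => y; rewrite /err FE.
rewrite errE in hc0 hc1; rewrite FE.
have e0e : e0 <= e0 + e1 by rewrite lerDl.
have e1e : e1 <= e0 + e1 by rewrite lerDr.
apply: (le_trans (velocity_error_le hg d0 hr hL sf supp oM hW hWh k0 hfl e0k e0e e1e hc0 hc1 vO)).
rewrite -/mass; set T := kappa^-1 * rate + _.
apply: (@le_trans _ _ (d%:R * (16 * (mass * (V x * W x)) + 80 * (W x ^+ 2 * mass)) * T)); last first.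
  by rewrite ler_wpM2r // lerDl.
rewrite -[leRHS]mulrA ler_wpM2l // [leRHS]mulrDl.
have X0 : 0 <= 16 * (mass * (V x * W x)) by rewrite !mulr_ge0.
have Y0 : 0 <= 80 * (W x ^+ 2 * mass) by rewrite !mulr_ge0 ?exprn_ge0.
apply: lerD.
  have -> : 16 * (mass * (V x * rate * W x)) / kappa =
    16 * (mass * (V x * W x)) * (kappa^-1 * rate) by ring.
  by rewrite ler_wpM2l // lerDl mulr_ge0 ?addr_ge0 ?(ltW k2).
have -> : 80 * (W x ^+ 2 * mass) * (e0 + e1) / kappa ^+ 2 =
  80 * (W x ^+ 2 * mass) * ((kappa ^+ 2)^-1 * (e0 + e1)) by ring.
by rewrite ler_wpM2l // lerDr mulr_ge0 // invr_ge0 ltW.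
Qed.
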